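(* Let $\Omega \subset \mathbb{C}$ be a hyperbolic domain with universal covering map $f_{\Omega}\colon\mathbb{D}\to\Omega$, and let $v$ be a typical weight for which all composition operators $C_g$, $g\in\mathrm{Hol}(\mathbb{D},\mathbb{D})$, are bounded on $\mathrm{H}^{\infty}_v$. Assume that $0 \in \Omega$. The following facts are equivalent: (a) $\mathrm{Hol}(\mathbb{D},\Omega) \subset \mathrm{H}^{\infty}_v$; (b) $f_{\Omega} \in \mathrm{H}^{\infty}_v$; (c) $\displaystyle\sup_{w \in \Omega}|w|\,v\left(\dfrac{e^{d_{\Omega}(0,w)}-1}{e^{d_{\Omega}(0,w)}+1}\right) < +\infty$.
   Context: $\mathbb{D}$ is the open unit disk and $\mathrm{Hol}(\mathbb{D},\Omega)$ is the set of holomorphic maps on $\mathbb{D}$ with values in $\Omega$. A domain is an open connected subset of $\mathbb{C}$; it is hyperbolic if $\mathbb{C}\setminus\Omega$ contains at least two points, in which case there is a holomorphic universal covering map $f_\Omega\colon\mathbb{D}\to\Omega$. A weight $v\colon\mathbb{D}\to[0,+\infty)$ is typical if $v(z)>0$ for all $z$, $v$ is radial ($v(z)=v(|z|)$), $v$ is continuous and non-increasing with respect to $|z|$, and $\lim_{|z|\to1^-}v(z)=0$. $\mathrm{H}^\infty_v$ is the space of holomorphic $f\colon\mathbb{D}\to\mathbb{C}$ with $\sup_{z\in\mathbb{D}}|f(z)|v(z)<+\infty$, normed by this supremum. For $g\in\mathrm{Hol}(\mathbb{D},\mathbb{D})$, $C_g(f)=f\circ g$. Hyperbolic distance: for $z_1,z_2\in\mathbb{D}$,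 $d_{\mathbb{D}}(z_1,z_2)=\log\frac{1+\rho}{1-\rho}$ with $\rho=\left|\frac{z_1-z_2}{1-z_1\overline{z_2}}\right|$. For a hyperbolic domain $\Omega$ and $w_1,w_2\in\Omega$, $d_\Omega(w_1,w_2)=\inf\{d_{\mathbb{D}}(a,b): a,b\in\mathbb{D},\ f_\Omega(a)=w_1,\ f_\Omega(b)=w_2\}$ (independent of the choice of $f_\Omega$). *)

(* Defs.v *)
From Stdlib Require Export Reals.
From Coquelicot Require Export Coquelicot.

Open Scope R_scope.

(* Maps, weights and sets live on all of [C]; only the values on the open sets
   named in each definition matter. *)

Definition unit_disk (z : C) : Prop := Cmod z < 1.

Definition connected_set (A : C -> Prop) : Prop :=
  forall U V : C -> Prop,
    open U -> open V ->
    (forall z, A z -> U z \/ V z) ->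
    (exists z, A z /\ U z) ->
    (exists z, A z /\ V z) ->
    exists z, A z /\ U z /\ V z.

Definition domain (Omega : C -> Prop) : Prop :=
  open Omega /\ connected_set Omega.

Definition hyperbolic_domain (Omega : C -> Prop) : Prop :=
  domain Omega /\ exists a b : C, a <> b /\ ~ Omega a /\ ~ Omega b.

(* [ex_derive] is differentiability over the field [C]. *)
Definition holomorphic_on (A : C -> Prop) (f : C -> C) : Prop :=
  forall z : C, A z -> ex_derive f z.

Definition Hol (A B : C -> Prop) (f : C -> C) : Prop :=
  holomorphic_on A f /\ forall z : C, A z -> B (f z).

(* [f] restricts to a homeomorphism of the open set [V] onto the open set [U]. *)
Definition homeomorphism_onto (V U : C -> Prop) (f : C -> C) : Prop :=
  (forall z, V z -> U (f z) /\ continuous f z) /\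
  exists s : C -> C,
    (forall w, U w -> V (s w) /\ continuous s w /\ f (s w) = w) /\
    (forall z, V z -> s (f z) = z).

Definition evenly_covered (f : C -> C) (A U : C -> Prop) : Prop :=
  exists (I : Type) (V : I -> C -> Prop),
    (forall i, open (V i)) /\
    (forall i j z, V i z -> V j z -> i = j) /\
    (forall z, (A z /\ U (f z)) <-> exists i, V i z) /\
    (forall i, homeomorphism_onto (V i) U f).

(* For open [A] and [B]. *)
Definition covering_map (f : C -> C) (A B : C -> Prop) : Prop :=
  (forall z, A z -> B (f z) /\ continuous f z) /\
  (forall w, B w -> exists z, A z /\ f z = w) /\
  (forall w, B w -> exists U : C -> Prop,
     open U /\ U w /\ (forall u, U u -> B u) /\ evenly_covered f A U).

(* Every covering by the disk is universal, the disk being simply connected. *)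
Definition holomorphic_universal_covering
    (Omega : C -> Prop) (f : C -> C) : Prop :=
  Hol unit_disk Omega f /\ covering_map f unit_disk Omega.

Definition d_disk (z1 z2 : C) : R :=
  let rho := Cmod ((z1 - z2) / (1 - z1 * Cconj z2))%C in
  ln ((1 + rho) / (1 - rho)).

(* The hyperbolic distance of the domain covered by [f]. *)
Definition d_hyp (f : C -> C) (w1 w2 : C) : R :=
  real (Glb_Rbar (fun d : R => exists a b : C,
    unit_disk a /\ unit_disk b /\ f a = w1 /\ f b = w2 /\ d = d_disk a b)).

Definition typical_weight (v : C -> R) : Prop :=
  (forall z, unit_disk z -> 0 < v z) /\
  (forall z, unit_disk z -> v z = v (RtoC (Cmod z))) /\
  (forall z, unit_disk z -> continuous v z) /\
  (forall z w, unit_disk z -> unit_disk w -> Cmod z <= Cmod w -> v w <= v z) /\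
  filterlim (fun r : R => v (RtoC r)) (at_left 1) (locally 0).

Definition sup_v (v : C -> R) (f : C -> C) : Rbar :=
  Lub_Rbar (fun x : R => exists z : C, unit_disk z /\ x = Cmod (f z) * v z).

Definition H_v (v : C -> R) (f : C -> C) : Prop :=
  holomorphic_on unit_disk f /\ Rbar_lt (sup_v v f) p_infty.

Definition norm_v (v : C -> R) (f : C -> C) : R := real (sup_v v f).

Definition composition_bounded (v : C -> R) (g : C -> C) : Prop :=
  exists M : R, forall f : C -> C, H_v v f ->
    H_v v (fun z => f (g z)) /\
    norm_v v (fun z => f (g z)) <= M * norm_v v f.

(* Main.v *)
Require Import Defs.
From Stdlib Require Import Lra Classical ClassicalEpsilon.

(** Every map into [Omega] lifts through the covering [fOmega] to a self-map [g] of the disk, so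
    [(b) -> (a)] is the boundedness of [C_g]. For [(b) <-> (c)], fix [a0] over [0] and let [phi]
    be the disk automorphism exchanging [a0] and [0]. Lifting [fOmega] through itself, with any
    point [a] over [0] sent to [a0], and applying the Schwarz-Pick lemma shows that the infimum
    defining the distance from [0] to [w] may be taken over the pairs [(a0, b)] only; so [(c)]
    says that [fOmega o phi] is in [H_v], and [C_phi] exchanges [fOmega] and [fOmega o phi].

    Lifts are holomorphic because a locally injective holomorphic map has nonzero derivative.
    This and the Schwarz lemma follow from the maximum principle for functions that are
    holomorphic except at one point, where they are only continuous. The maximum principle comes
    from the mean value property, obtained by Goursat's bisection argument applied to the closed
    form [Im (F dz / z)] in polar coordinates. *)

(** * Complex differentiability *)

(** Holomorphy is bare pointwise differentiability, so the derivative is not known to be continuous;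
    this is why a closed form has to be integrated by bisection rather than by Green's formula. The
    exceptional point in the maximum principle comes from difference quotients: [h z / z] and
    [(f x - f a) / (x - a)] extend continuously to the centre, but their differentiability there is
    a consequence of Cauchy's theory, not an input to it.

    Convexity of the disk takes the place of homotopies: lifts are continued along segments from the
    base point, and any two of them agree because the neighbourhoods on which they live meet in
    convex sets.

    The expression [(exp d - 1) / (exp d + 1)] in (c) is [tanh (d / 2)], the inverse of
    [rho -> ln ((1 + rho) / (1 - rho))], so it turns a hyperbolic distance from the origin back into
    a modulus. The distance of [Omega] is an infimum over pairs of preimages; since [v] is
    non-increasing, a bound valid for every pair does not pass to the infimum by monotonicity, and
    the continuity of [v] is what carries it over. *)

Definition ccont (f : C -> C) (z : C) : Prop :=
  forall e, 0 < e -> exists d, 0 < d /\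
    forall x, Cmod (x - z) < d -> Cmod (f x - f z) < e.

(* Caratheodory's form of the derivative: the differentiation rules become algebra. *)
Definition cder (f : C -> C) (z l : C) : Prop :=
  exists q : C -> C, ccont q z /\ q z = l /\
    forall x, f x = (f z + q x * (x - z))%C.

Definition cdiff (f : C -> C) (z : C) : Prop := exists l, cder f z l.

Lemma Cmod_sub_sym (x y : C) : Cmod (x - y) = Cmod (y - x).
Proof. rewrite <- Cmod_opp. f_equal. ring. Qed.

Lemma Cmod_sub_triangle (x y z : C) : Cmod (x - z) <= Cmod (x - y) + Cmod (y - z).
Proof. replace (x - z)%C with ((x - y) + (y - z))%C by ring. apply Cmod_triangle. Qed.

Lemma Cmod_le_add_sub (x y : C) : Cmod x <= Cmod y + Cmod (x - y).
Proof. replace x with (y + (x - y))%C at 1 by ring. apply Cmod_triangle. Qed.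

Lemma Cmod_sub_diag (x : C) : Cmod (x - x) = 0.
Proof. replace (x - x)%C with (RtoC 0) by ring. apply Cmod_0. Qed.

Lemma Cmod_sub_pos (x y : C) : x <> y -> 0 < Cmod (x - y).
Proof.
  intros H. apply Cmod_gt_0. intros E. apply H.
  replace x with ((x - y) + y)%C by ring. rewrite E. ring.
Qed.

Lemma ccont_const (c z : C) : ccont (fun _ => c) z.
Proof. intros e He. exists 1. split; [lra|]. intros x _. rewrite Cmod_sub_diag. lra. Qed.

Lemma ccont_id (z : C) : ccont (fun x => x) z.
Proof. intros e He. exists e. auto. Qed.

Lemma ccont_ext_loc (f g : C -> C) (z : C) (d : R) : 0 < d ->
  (forall x, Cmod (x - z) < d -> f x = g x) -> ccont f z -> ccont g z.
Proof.
  intros Hd E H e He. destruct (H e He) as [d' [Hd' H']].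
  exists (Rmin d d'). split; [apply Rmin_pos; auto|].
  intros x Hx. pose proof (Rmin_l d d'). pose proof (Rmin_r d d').
  rewrite <- !E. apply H'; lra. rewrite Cmod_sub_diag; lra. lra.
Qed.

Lemma ccont_plus (f g : C -> C) (z : C) :
  ccont f z -> ccont g z -> ccont (fun x => f x + g x)%C z.
Proof.
  intros Hf Hg e He.
  destruct (Hf (e/2)) as [d1 [Hd1 H1]]; [lra|].
  destruct (Hg (e/2)) as [d2 [Hd2 H2]]; [lra|].
  exists (Rmin d1 d2). split; [apply Rmin_pos; auto|].
  intros x Hx. pose proof (Rmin_l d1 d2). pose proof (Rmin_r d1 d2).
  specialize (H1 x ltac:(lra)). specialize (H2 x ltac:(lra)).
  replace (f x + g x - (f z + g z))%C with ((f x - f z) + (g x - g z))%C by ring.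
  pose proof (Cmod_triangle (f x - f z) (g x - g z)). lra.
Qed.

Lemma ccont_mult (f g : C -> C) (z : C) :
  ccont f z -> ccont g z -> ccont (fun x => f x * g x)%C z.
Proof.
  intros Hf Hg e He.
  pose proof (Cmod_ge_0 (f z)) as Pf. pose proof (Cmod_ge_0 (g z)) as Pg.
  set (k := Cmod (f z) + Cmod (g z) + 1).
  assert (Hk : 0 < k) by (unfold k; lra).
  (* [e' <= 1] absorbs the product of the two increments: the total error is at most [e' * k]. *)
  set (e' := Rmin 1 (e / (2 * k))).
  assert (He1 : 0 < e / (2*k)) by (apply Rdiv_lt_0_compat; lra).
  assert (He' : 0 < e') by (apply Rmin_pos; lra).
  pose proof (Rmin_l 1 (e / (2*k))) as L1. pose proof (Rmin_r 1 (e / (2*k))) as L2.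
  fold e' in L1, L2.
  assert (Hek : e' * k < e).
  { apply Rle_lt_trans with (e / (2*k) * k).
    apply Rmult_le_compat_r; lra. replace (e/(2*k)*k) with (e/2) by (field; lra). lra. }
  destruct (Hf e' He') as [d1 [Hd1 H1]]. destruct (Hg e' He') as [d2 [Hd2 H2]].
  exists (Rmin d1 d2). split; [apply Rmin_pos; auto|].
  intros x Hx. pose proof (Rmin_l d1 d2). pose proof (Rmin_r d1 d2).
  specialize (H1 x ltac:(lra)). specialize (H2 x ltac:(lra)).
  replace (f x * g x - f z * g z)%C
    with ((f x - f z) * (g x - g z) + ((f x - f z) * g z + f z * (g x - g z)))%C by ring.
  eapply Rle_lt_trans; [apply Cmod_triangle|].
  eapply Rle_lt_trans; [apply Rplus_le_compat_l; apply Cmod_triangle|].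
  rewrite !Cmod_mult.
  pose proof (Cmod_ge_0 (f x - f z)). pose proof (Cmod_ge_0 (g x - g z)).
  unfold k in Hek. nra.
Qed.

Lemma ccont_comp (f g : C -> C) (z : C) :
  ccont g z -> ccont f (g z) -> ccont (fun x => f (g x)) z.
Proof.
  intros Hg Hf e He. destruct (Hf e He) as [d [Hd H]].
  destruct (Hg d Hd) as [d' [Hd' H']]. exists d'. split; auto.
Qed.

Lemma ccont_nonzero (f : C -> C) (z : C) :
  ccont f z -> f z <> RtoC 0 -> exists d, 0 < d /\ forall x, Cmod (x - z) < d ->
    Cmod (f z) / 2 < Cmod (f x).
Proof.
  intros Hf Hz. assert (Hp : 0 < Cmod (f z)) by (apply Cmod_gt_0; auto).
  destruct (Hf (Cmod (f z) / 2)) as [d [Hd H]]; [lra|].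
  exists d. split; auto. intros x Hx. specialize (H x Hx).
  pose proof (Cmod_le_add_sub (f z) (f x)). rewrite Cmod_sub_sym in H0. lra.
Qed.

Lemma ccont_inv (f : C -> C) (z : C) :
  ccont f z -> f z <> RtoC 0 -> ccont (fun x => / f x)%C z.
Proof.
  intros Hf Hz e He. assert (Hp : 0 < Cmod (f z)) by (apply Cmod_gt_0; auto).
  set (m := Cmod (f z)) in *.
  destruct (ccont_nonzero f z Hf Hz) as [d1 [Hd1 H1]]. fold m in H1.
  (* Near [z] the denominator [|f x| |f z|] exceeds [m * m / 2]. *)
  destruct (Hf (e * m * m / 2)) as [d2 [Hd2 H2]].
  { apply Rmult_lt_0_compat; [|lra]. apply Rmult_lt_0_compat; auto.
    apply Rmult_lt_0_compat; auto. }
  exists (Rmin d1 d2). split; [apply Rmin_pos; auto|].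
  intros x Hx. pose proof (Rmin_l d1 d2). pose proof (Rmin_r d1 d2).
  specialize (H1 x ltac:(lra)). specialize (H2 x ltac:(lra)).
  assert (Hx0 : f x <> RtoC 0) by (intros E; rewrite E, Cmod_0 in H1; lra).
  replace (/ f x - / f z)%C with ((f z - f x) / (f x * f z))%C by (field; auto).
  rewrite Cmod_div, Cmod_mult, Cmod_sub_sym; [|apply Cmult_neq_0; auto]. fold m.
  apply Rmult_lt_reg_r with (Cmod (f x) * m); [nra|].
  unfold Rdiv. rewrite Rmult_assoc, Rinv_l by nra. rewrite Rmult_1_r.
  eapply Rlt_trans; [exact H2|].
  replace (e * m * m / 2) with (e * m * (m / 2)) by field.
  rewrite <- Rmult_assoc. rewrite (Rmult_comm (e * Cmod (f x))).
  rewrite <- Rmult_assoc, (Rmult_comm m e).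
  apply Rmult_lt_compat_l; nra.
Qed.

Lemma cder_cont (f : C -> C) (z l : C) : cder f z l -> ccont f z.
Proof.
  intros [q [Hq [_ E]]].
  apply ccont_ext_loc with (fun x => f z + q x * (x + - z))%C 1; [lra| |].
  - intros x _. symmetry. apply E.
  - apply ccont_plus; [apply ccont_const|]. apply ccont_mult; auto.
    apply ccont_plus; [apply ccont_id|apply ccont_const].
Qed.

Lemma cdiff_cont (f : C -> C) (z : C) : cdiff f z -> ccont f z.
Proof. intros [l H]. eapply cder_cont; eauto. Qed.

(** The global identity in [cder] is no restriction: the difference quotient, completed by [l] at
    [z], satisfies it everywhere and coincides with [q] near [z]. *)
Lemma cder_loc (f q : C -> C) (z l : C) (d : R) : 0 < d ->
  ccont q z -> q z = l ->
  (forall x, Cmod (x - z) < d -> f x = f z + q x * (x - z))%C -> cder f z l.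
Proof.
  intros Hd Hq Hl E.
  exists (fun x => if excluded_middle_informative (x = z) then l
     else ((f x - f z) / (x - z))%C). repeat split.
  - apply ccont_ext_loc with q d; auto. intros x Hx.
    destruct (excluded_middle_informative (x = z)) as [->|N]; auto.
    rewrite E by auto. field. intros E'. apply N.
    replace x with ((x - z) + z)%C by ring. rewrite E'. ring.
  - destruct (excluded_middle_informative (z = z)); auto; easy.
  - intros x. destruct (excluded_middle_informative (x = z)) as [->|N]. ring.
    field. intros E'. apply N. replace x with ((x - z) + z)%C by ring. rewrite E'. ring.
Qed.

Lemma cder_ext_loc (f g : C -> C) (z l : C) (d : R) : 0 < d ->
  (forall x, Cmod (x - z) < d -> f x = g x) -> cder f z l -> cder g z l.
Proof.
  intros Hd E [q [Hq [Hl H]]]. apply cder_loc with q d; auto.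
  intros x Hx. rewrite <- !E; auto. rewrite Cmod_sub_diag; auto.
Qed.

Lemma cdiff_ext_loc (f g : C -> C) (z : C) (d : R) : 0 < d ->
  (forall x, Cmod (x - z) < d -> f x = g x) -> cdiff f z -> cdiff g z.
Proof. intros Hd E [l H]. exists l. eapply cder_ext_loc; eauto. Qed.

Lemma cder_const (c z : C) : cder (fun _ => c) z 0.
Proof.
  exists (fun _ => RtoC 0). split; [apply ccont_const|]. split; [easy|].
  intros x. ring.
Qed.

Lemma cder_id (z : C) : cder (fun x => x) z 1.
Proof.
  exists (fun _ => RtoC 1). split; [apply ccont_const|]. split; [easy|].
  intros x. ring.
Qed.

Lemma cdiff_const (c z : C) : cdiff (fun _ => c) z.
Proof. eexists; apply cder_const. Qed.

Lemma cdiff_id (z : C) : cdiff (fun x => x) z.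
Proof. eexists; apply cder_id. Qed.

Lemma cdiff_plus (f g : C -> C) (z : C) :
  cdiff f z -> cdiff g z -> cdiff (fun x => f x + g x)%C z.
Proof.
  intros [l [q [Hq [_ E]]]] [m [s [Hs [_ G]]]].
  exists (q z + s z)%C, (fun x => q x + s x)%C.
  split; [apply ccont_plus; auto|]. split; [easy|].
  intros x. rewrite (E x), (G x). ring.
Qed.

Lemma cdiff_mult (f g : C -> C) (z : C) :
  cdiff f z -> cdiff g z -> cdiff (fun x => f x * g x)%C z.
Proof.
  intros [l [q [Hq [_ E]]]] Hg. pose proof (cdiff_cont _ _ Hg) as Cg.
  destruct Hg as [m [s [Hs [_ G]]]].
  exists (q z * g z + f z * s z)%C, (fun x => q x * g x + f z * s x)%C.
  split; [|split; [easy|]].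
  - apply ccont_plus; apply ccont_mult; auto; apply ccont_const.
  - intros x. rewrite (E x), (G x). ring.
Qed.

Lemma cdiff_comp (f g : C -> C) (z : C) :
  cdiff g z -> cdiff f (g z) -> cdiff (fun x => f (g x)) z.
Proof.
  intros Hg. pose proof (cdiff_cont _ _ Hg) as Cg.
  destruct Hg as [m [s [Hs [_ G]]]]. intros [l [q [Hq [_ E]]]].
  exists (q (g z) * s z)%C, (fun x => q (g x) * s x)%C.
  split; [|split; [easy|]].
  - apply ccont_mult; auto. apply (ccont_comp q g); auto.
  - intros x. rewrite (E (g x)).
    replace (g x - g z)%C with (s x * (x - z))%C by (rewrite (G x); ring). ring.
Qed.

Lemma cdiff_inv (f : C -> C) (z : C) :
  cdiff f z -> f z <> RtoC 0 -> cdiff (fun x => / f x)%C z.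
Proof.
  intros Hf Hz. pose proof (cdiff_cont _ _ Hf) as Cf.
  destruct (ccont_nonzero f z Cf Hz) as [d [Hd H]].
  destruct Hf as [l [q [Hq [Hl E]]]].
  exists (- q z / (f z * f z))%C.
  apply cder_loc with (fun x => (-(1)) * q x * / (f x * f z))%C d; auto.
  - apply ccont_mult. apply ccont_mult; auto. apply ccont_const.
    apply ccont_inv. apply ccont_mult; auto. apply ccont_const.
    apply Cmult_neq_0; auto.
  - field. auto.
  - intros x Hx. specialize (H x Hx).
    assert (Hp : 0 < Cmod (f z)) by (apply Cmod_gt_0; auto).
    assert (Hx0 : f x <> RtoC 0) by (intros E'; rewrite E', Cmod_0 in H; lra).
    replace (-(1) * q x * / (f x * f z) * (x - z))%C
      with (-(1) * (q x * (x - z)) / (f x * f z))%C by (field; auto).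
    replace (q x * (x - z))%C with (f x - f z)%C by (rewrite (E x); ring).
    field; auto.
Qed.

(** * Agreement with the derivative, continuity and open sets of Coquelicot *)

Lemma is_derive_cder (f : C -> C) (z l : C) : is_derive f z l <-> cder f z l.
Proof.
  split.
  - intros [_ H].
    specialize (H z (fun P HP => HP)).
    apply cder_loc with (fun x => if excluded_middle_informative (x = z) then l
     else ((f x - f z) / (x - z))%C) 1; [lra| | |].
    (* The little-o estimate is a non-strict inequality; half of [e] makes it strict. *)
    + intros e He. assert (He2 : 0 < e / 2) by lra.
      specialize (H (mkposreal _ He2)). simpl in H.
      destruct H as [d H]. exists d. split; [apply cond_pos|].
      intros x Hx. specialize (H x Hx).
      destruct (excluded_middle_informative (z = z)) as [_|N]; [|easy].
      destruct (excluded_middle_informative (x = z)) as [->|N].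
      rewrite Cmod_sub_diag; auto.
      change (Cmod (f x - f z - (x - z) * l) <= e / 2 * Cmod (x - z)) in H.
      pose proof (Cmod_sub_pos _ _ N) as Hp.
      assert (N' : (x - z)%C <> RtoC 0) by (apply Cmod_gt_0; auto).
      replace ((f x - f z) / (x - z) - l)%C
        with ((f x - f z - (x - z) * l) / (x - z))%C by (field; auto).
      rewrite Cmod_div by auto. apply Rle_lt_trans with (e / 2); [|lra].
      apply Rmult_le_reg_r with (Cmod (x - z)); auto.
      unfold Rdiv at 1. rewrite Rmult_assoc, Rinv_l by lra. lra.
    + destruct (excluded_middle_informative (z = z)); auto; easy.
    + intros x _. destruct (excluded_middle_informative (x = z)) as [->|N]. ring.
      field. apply Cmod_gt_0. apply Cmod_sub_pos; auto.
  - intros [q [Hq [Hl E]]]. split.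
    + apply (is_linear_scal_l (K := C_AbsRing) (V := C_NormedModule)).
    (* The little-o clause is stated at any limit [y] of the filter of neighbourhoods of [z]; such a
       limit is [z]. *)
    + intros y Hy.
      apply (is_filter_lim_locally_unique (K := C_AbsRing)
        (V := AbsRing_NormedModule C_AbsRing)) in Hy. subst y.
      intros e. destruct (Hq e (cond_pos e)) as [d [Hd H]].
      exists (mkposreal d Hd). intros x Hx. specialize (H x Hx).
      change (Cmod (f x - f z - (x - z) * l) <= e * Cmod (x - z)).
      rewrite (E x).
      replace (f z + q x * (x - z) - f z - (x - z) * l)%C
        with ((q x - q z) * (x - z))%C by (rewrite Hl; ring).
      rewrite Cmod_mult. apply Rmult_le_compat_r; [apply Cmod_ge_0|lra].
Qed.

Lemma ex_derive_cdiff (f : C -> C) (z : C) : ex_derive f z <-> cdiff f z.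
Proof. split; intros [l H]; exists l; apply is_derive_cder; exact H. Qed.

Lemma locally_Cmod (z : C) (P : C -> Prop) :
  locally z P <-> exists d, 0 < d /\ forall x, Cmod (x - z) < d -> P x.
Proof.
  split.
  - intros H. apply (locally_norm_le_locally (K := C_AbsRing) (V := C_NormedModule)) in H.
    destruct H as [d H]. exists d. split; [apply cond_pos|]. exact H.
  - intros [d [Hd H]].
    apply (locally_le_locally_norm (K := C_AbsRing) (V := C_NormedModule)).
    exists (mkposreal d Hd). exact H.
Qed.

Lemma continuous_ccont (f : C -> C) (z : C) : continuous f z <-> ccont f z.
Proof.
  split.
  - intros H e He. apply locally_Cmod. apply (H (fun y => Cmod (y - f z) < e)).
    apply locally_Cmod. exists e. auto.
  - intros H P HP. apply locally_Cmod in HP. destruct HP as [e [He HP]].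
    apply locally_Cmod. destruct (H e He) as [d [Hd H']]. exists d. auto.
Qed.

Lemma open_Cmod (U : C -> Prop) (z : C) : open U -> U z ->
  exists d, 0 < d /\ forall x, Cmod (x - z) < d -> U x.
Proof. intros H Hz. apply locally_Cmod. apply H. exact Hz. Qed.

(** * Goursat's theorem on rectangles *)

Lemma pow_half_small (w e : R) : 0 < e -> exists n, w / 2 ^ n < e.
Proof.
  intros He.
  assert (H12 : Rabs (/ 2) < 1) by (rewrite Rabs_pos_eq; lra).
  destruct (Rle_lt_dec w 0) as [Hw|Hw].
  - exists 0%nat. simpl. lra.
  - destruct (pow_lt_1_zero (/ 2) H12 (e / w)) as [N HN]; [apply Rdiv_lt_0_compat; auto|].
    exists N. specialize (HN N (Nat.le_refl _)). rewrite pow_inv in HN.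
    assert (0 < 2 ^ N) by (apply pow_lt; lra).
    rewrite Rabs_pos_eq in HN by (left; apply Rinv_0_lt_compat; auto).
    apply Rmult_lt_compat_l with (r := w) in HN; auto.
    replace (w * (e / w)) with e in HN by (field; lra). exact HN.
Qed.

(** Every left endpoint lies below every right endpoint, so the supremum of the left endpoints
    belongs to all the intervals. *)
Lemma nested_point (a : nat -> R) (w : R) : 0 <= w ->
  (forall n, a n <= a (S n)) ->
  (forall n, a (S n) + w / 2 ^ S n <= a n + w / 2 ^ n) ->
  exists p, forall n, a n <= p <= a n + w / 2 ^ n.
Proof.
  intros Hw H1 H2.
  assert (Hp : forall n, 0 <= w / 2 ^ n).
  { intros n. apply Rmult_le_pos; auto. left. apply Rinv_0_lt_compat. apply pow_lt; lra. }
  assert (I : forall n k, a n <= a (n + k)%nat /\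
     a (n + k)%nat + w / 2 ^ (n + k) <= a n + w / 2 ^ n).
  { intros n k. induction k as [|k IH].
    - rewrite Nat.add_0_r. lra.
    - rewrite Nat.add_succ_r. specialize (H1 (n + k)%nat). specialize (H2 (n + k)%nat). lra. }
  assert (U : forall n m, a n <= a m + w / 2 ^ m).
  { intros n m. destruct (I n m) as [I1 _]. destruct (I m n) as [_ I2].
    rewrite (Nat.add_comm m n) in I2. specialize (Hp (n + m)%nat). lra. }
  destruct (completeness (fun x => exists n, x = a n)) as [p [Hp1 Hp2]].
  - exists (a 0%nat + w / 2 ^ 0). intros x [n ->]. apply U.
  - exists (a 0%nat). exists 0%nat. auto.
  - exists p. intros n. split.
    + apply Hp1. exists n. auto.
    + apply Hp2. intros x [m ->]. apply U.
Qed.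

(** If [P] failed for the whole rectangle, it would fail for one quarter at each level; these
    quarters shrink to a point, where the local hypothesis is contradicted. The level [n] is an
    argument of [P] because it encodes the size of the rectangle. Both Goursat's theorem and
    compactness are obtained from this principle. *)
Lemma rectangle_induction (P : nat -> R -> R -> Prop) (x y w h : R) :
  0 <= w -> 0 <= h ->
  (forall n a b, P (S n) a b -> P (S n) (a + w / 2 ^ S n) b ->
     P (S n) a (b + h / 2 ^ S n) ->
     P (S n) (a + w / 2 ^ S n) (b + h / 2 ^ S n) -> P n a b) ->
  (forall p q, x <= p <= x + w -> y <= q <= y + h -> exists d, 0 < d /\
     forall n a b, w / 2 ^ n < d -> h / 2 ^ n < d ->
       x <= a -> a <= p <= a + w / 2 ^ n -> a + w / 2 ^ n <= x + w ->
       y <= b -> b <= q <= b + h / 2 ^ n -> b + h / 2 ^ n <= y + h -> P n a b) ->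
  P 0%nat x y.
Proof.
  intros Hw Hh Hsub Hloc. apply NNPP. intros Hnot.
  assert (half : forall s n, s / 2 ^ n = s / 2 ^ S n + s / 2 ^ S n).
  { intros s n. assert (0 < 2 ^ n) by (apply pow_lt; lra). simpl. field. lra. }
  assert (Hp : forall s n, 0 <= s -> 0 <= s / 2 ^ n).
  { intros s n Hs. apply Rmult_le_pos; auto. left. apply Rinv_0_lt_compat. apply pow_lt; lra. }
  (* [F] selects a quarter on which [P] still fails; where [P] holds its value is arbitrary. *)
  destruct (choice (fun (t : nat * (R * R)) (u : R * R) =>
    let (n, ab) := t in let (a, b) := ab in let (a', b') := u in
    ~ P n a b -> ~ P (S n) a' b' /\ a <= a' /\ a' + w / 2 ^ S n <= a + w / 2 ^ n /\
      b <= b' /\ b' + h / 2 ^ S n <= b + h / 2 ^ n)) as [F HF].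
  { intros [n [a b]].
    pose proof (half w n). pose proof (half h n).
    pose proof (Hp w (S n) Hw). pose proof (Hp h (S n) Hh).
    destruct (classic (P n a b)) as [Y|N]; [exists (0, 0); easy|].
    destruct (classic (P (S n) a b)) as [Y1|N1];
      [|exists (a, b); intros _; split; auto; lra].
    destruct (classic (P (S n) (a + w / 2 ^ S n) b)) as [Y2|N2];
      [|exists (a + w / 2 ^ S n, b); intros _; split; auto; lra].
    destruct (classic (P (S n) a (b + h / 2 ^ S n))) as [Y3|N3];
      [|exists (a, b + h / 2 ^ S n); intros _; split; auto; lra].
    destruct (classic (P (S n) (a + w / 2 ^ S n) (b + h / 2 ^ S n))) as [Y4|N4];
      [|exists (a + w / 2 ^ S n, b + h / 2 ^ S n); intros _; split; auto; lra].
    exfalso. apply N. apply Hsub; auto. }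
  set (u := fix u n := match n with O => (x, y) | S k => F (k, u k) end).
  assert (Hu : forall n, ~ P n (fst (u n)) (snd (u n))).
  { induction n as [|n IH]; [exact Hnot|]. simpl.
    specialize (HF (n, u n)). destruct (u n) as [a b].
    destruct (F (n, (a, b))) as [a' b']. simpl in *. apply HF. exact IH. }
  assert (Hs : forall n,
     fst (u n) <= fst (u (S n)) /\ fst (u (S n)) + w / 2 ^ S n <= fst (u n) + w / 2 ^ n /\
     snd (u n) <= snd (u (S n)) /\ snd (u (S n)) + h / 2 ^ S n <= snd (u n) + h / 2 ^ n).
  { intros n. specialize (Hu n). specialize (HF (n, u n)).
    change (u (S n)) with (F (n, u n)). destruct (u n) as [a b].
    destruct (F (n, (a, b))) as [a' b']. apply HF. exact Hu. }
  destruct (nested_point (fun n => fst (u n)) w Hw) as [p Hpp]; try (intros n; apply Hs).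
  destruct (nested_point (fun n => snd (u n)) h Hh) as [q Hqq]; try (intros n; apply Hs).
  assert (I : forall n, x <= fst (u n) /\ fst (u n) + w / 2 ^ n <= x + w /\
     y <= snd (u n) /\ snd (u n) + h / 2 ^ n <= y + h).
  { induction n as [|n IH]. simpl. lra. specialize (Hs n). lra. }
  destruct (Hloc p q) as [d [Hd H]].
  { pose proof (Hpp 0%nat). simpl in *. lra. }
  { pose proof (Hqq 0%nat). simpl in *. lra. }
  destruct (pow_half_small (Rmax w h) d Hd) as [n Hn].
  assert (Hi : 0 < / 2 ^ n) by (apply Rinv_0_lt_compat; apply pow_lt; lra).
  apply (Hu n). specialize (I n). apply H; try apply I; auto.
  - eapply Rle_lt_trans; [|exact Hn]. apply Rmult_le_compat_r; [lra|apply Rmax_l].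
  - eapply Rle_lt_trans; [|exact Hn]. apply Rmult_le_compat_r; [lra|apply Rmax_r].
Qed.

Lemma differentiable_pt_lim_cont_x (f : R -> R -> R) (p q l m : R) :
  differentiable_pt_lim f p q l m -> continuous (fun t => f t q) p.
Proof.
  intros H. apply (ex_derive_continuous (K := R_AbsRing) (V := R_NormedModule)).
  exists (l * 1 + m * 0). apply is_derive_Reals.
  apply (derivable_pt_lim_comp_2d f (fun t => t) (fun _ => q)); auto.
  apply derivable_pt_lim_id. apply derivable_pt_lim_const.
Qed.

Lemma differentiable_pt_lim_cont_y (f : R -> R -> R) (p q l m : R) :
  differentiable_pt_lim f p q l m -> continuous (fun t => f p t) q.
Proof.
  intros H. apply (ex_derive_continuous (K := R_AbsRing) (V := R_NormedModule)).
  exists (l * 0 + m * 1). apply is_derive_Reals.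
  apply (derivable_pt_lim_comp_2d f (fun _ => p) (fun t => t)); auto.
  apply derivable_pt_lim_const. apply derivable_pt_lim_id.
Qed.

(** The integral of [A dx + B dy] counterclockwise around the rectangle with opposite corners
    [(a, b)] and [(a', b')]. *)
Definition boundary_integral (A B : R -> R -> R) (a b a' b' : R) : R :=
  RInt (fun x => A x b) a a' - RInt (fun x => A x b') a a'
  + (RInt (fun y => B a' y) b b' - RInt (fun y => B a y) b b').

Section goursat.
Variables (A B : R -> R -> R) (x y w h : R).
Hypothesis Hw : 0 <= w.
Hypothesis Hh : 0 <= h.
(** The shared number [m] expresses closedness: the derivative of [A] in the second variable equals
    that of [B] in the first, at each point separately. *)
Hypothesis Hclosed : forall p q, x <= p <= x + w -> y <= q <= y + h ->
  exists l m k, differentiable_pt_lim A p q l m /\ differentiable_pt_lim B p q m k.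

Lemma ex_RInt_horizontal (q a b : R) : y <= q <= y + h -> x <= a -> a <= b -> b <= x + w ->
  ex_RInt (fun t => A t q) a b.
Proof.
  intros. apply (ex_RInt_continuous (V := R_CompleteNormedModule)).
  intros z. rewrite Rmin_left, Rmax_right by lra. intros Hz.
  destruct (Hclosed z q) as [l [m [k [H' _]]]]; try lra.
  eapply differentiable_pt_lim_cont_x; eauto.
Qed.

Lemma ex_RInt_vertical (p a b : R) : x <= p <= x + w -> y <= a -> a <= b -> b <= y + h ->
  ex_RInt (fun t => B p t) a b.
Proof.
  intros. apply (ex_RInt_continuous (V := R_CompleteNormedModule)).
  intros z. rewrite Rmin_left, Rmax_right by lra. intros Hz.
  destruct (Hclosed p z) as [l [m [k [_ H']]]]; try lra.
  eapply differentiable_pt_lim_cont_y; eauto.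
Qed.

(** Each inner edge is traversed twice, in opposite directions. *)
Lemma boundary_integral_subdivide (a b c d e f : R) :
  x <= a -> a <= c -> c <= e -> e <= x + w ->
  y <= b -> b <= d -> d <= f -> f <= y + h ->
  boundary_integral A B a b e f =
  boundary_integral A B a b c d + boundary_integral A B c b e d
  + boundary_integral A B a d c f + boundary_integral A B c d e f.
Proof.
  intros. unfold boundary_integral.
  rewrite <- (RInt_Chasles (fun t => A t b) a c e) by (apply ex_RInt_horizontal; lra).
  rewrite <- (RInt_Chasles (fun t => A t f) a c e) by (apply ex_RInt_horizontal; lra).
  rewrite <- (RInt_Chasles (fun t => B a t) b d f) by (apply ex_RInt_vertical; lra).
  rewrite <- (RInt_Chasles (fun t => B e t) b d f) by (apply ex_RInt_vertical; lra).
  unfold plus; simpl. lra.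
Qed.

(** Replacing [A] and [B] by their affine approximations at [(p, q)] gives a closed form with zero
    boundary integral. The remainder is at most [e / 2 * (w' + h')] pointwise, and the boundary has
    length [2 * (w' + h')]. *)
Lemma boundary_integral_small (p q e : R) : 0 < e ->
  x <= p <= x + w -> y <= q <= y + h -> exists d, 0 < d /\
  forall a b w' h', 0 <= w' < d -> 0 <= h' < d ->
    x <= a -> a <= p <= a + w' -> a + w' <= x + w ->
    y <= b -> b <= q <= b + h' -> b + h' <= y + h ->
    Rabs (boundary_integral A B a b (a + w') (b + h')) <= e * (w' + h') ^ 2.
Proof.
  intros He Hp Hq. destruct (Hclosed p q Hp Hq) as [l [m [k [HA HB]]]].
  assert (He2 : 0 < e / 2) by lra.
  destruct (HA (mkposreal _ He2)) as [d1 H1]. destruct (HB (mkposreal _ He2)) as [d2 H2].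
  simpl in H1, H2.
  exists (Rmin d1 d2). split. apply Rmin_pos; apply cond_pos.
  intros a b w' h' Hw' Hh' Ha Hpa Ha' Hb Hqb Hb'.
  pose proof (Rmin_l d1 d2). pose proof (Rmin_r d1 d2).
  assert (near : forall u v, a <= u <= a + w' -> b <= v <= b + h' ->
    Rabs (A u v - A p q - (l * (u - p) + m * (v - q))) <= e / 2 * (w' + h') /\
    Rabs (B u v - B p q - (m * (u - p) + k * (v - q))) <= e / 2 * (w' + h')).
  { intros u v Hu Hv.
    assert (L1 : Rabs (u - p) <= w') by (apply Rabs_le; lra).
    assert (L2 : Rabs (v - q) <= h') by (apply Rabs_le; lra).
    assert (L3 : Rmax (Rabs (u - p)) (Rabs (v - q)) <= w' + h') by (apply Rmax_lub; lra).
    split; (eapply Rle_trans; [first [apply H1|apply H2]; lra|]);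
      apply Rmult_le_compat_l; lra. }
  (* Opposite sides are paired and their linear parts removed; the two corrections integrate to
     [m * w' * h'] with opposite signs and cancel in [I1 + I2]. *)
  set (I1 := RInt (fun t => A t b - A t (b + h') + m * h') a (a + w')).
  set (I2 := RInt (fun t => B (a + w') t - B a t - m * w') b (b + h')).
  assert (E1 : I1 = RInt (fun t => A t b) a (a + w') - RInt (fun t => A t (b + h')) a (a + w')
     + w' * (m * h')).
  { unfold I1. rewrite (RInt_plus (V := R_CompleteNormedModule)
      (fun t => A t b - A t (b + h')) (fun _ => m * h')).
    rewrite (RInt_minus (V := R_CompleteNormedModule) (fun t => A t b) (fun t => A t (b + h'))).
    rewrite RInt_const. unfold plus, minus, scal, opp; simpl. unfold mult, plus, opp; simpl. lra.
    apply ex_RInt_horizontal; lra. apply ex_RInt_horizontal; lra.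
    apply (ex_RInt_minus (V := R_CompleteNormedModule)); apply ex_RInt_horizontal; lra.
    apply ex_RInt_const. }
  assert (E2 : I2 = RInt (fun t => B (a + w') t) b (b + h') - RInt (fun t => B a t) b (b + h')
     - h' * (m * w')).
  { unfold I2. rewrite (RInt_minus (V := R_CompleteNormedModule)
      (fun t => B (a + w') t - B a t) (fun _ => m * w')).
    rewrite (RInt_minus (V := R_CompleteNormedModule) (fun t => B (a + w') t) (fun t => B a t)).
    rewrite RInt_const. unfold plus, minus, scal, opp; simpl. unfold mult, plus, opp; simpl. lra.
    apply ex_RInt_vertical; lra. apply ex_RInt_vertical; lra.
    apply (ex_RInt_minus (V := R_CompleteNormedModule)); apply ex_RInt_vertical; lra.
    apply ex_RInt_const. }
  replace (boundary_integral A B a b (a + w') (b + h')) with (I1 + I2)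
    by (unfold boundary_integral; rewrite E1, E2; lra).
  assert (B1 : Rabs I1 <= (a + w' - a) * (e * (w' + h'))).
  { apply abs_RInt_le_const. lra.
    - apply (ex_RInt_plus (V := R_CompleteNormedModule)); [|apply ex_RInt_const].
      apply (ex_RInt_minus (V := R_CompleteNormedModule)); apply ex_RInt_horizontal; lra.
    - intros t Ht.
      destruct (near t b) as [N1 _]; try lra. destruct (near t (b + h')) as [N2 _]; try lra.
      apply Rabs_le. apply Rabs_le_between in N1. apply Rabs_le_between in N2. nra. }
  assert (B2 : Rabs I2 <= (b + h' - b) * (e * (w' + h'))).
  { apply abs_RInt_le_const. lra.
    - apply (ex_RInt_minus (V := R_CompleteNormedModule)); [|apply ex_RInt_const].
      apply (ex_RInt_minus (V := R_CompleteNormedModule)); apply ex_RInt_vertical; lra.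
    - intros t Ht.
      destruct (near (a + w') t) as [_ N1]; try lra. destruct (near a t) as [_ N2]; try lra.
      apply Rabs_le. apply Rabs_le_between in N1. apply Rabs_le_between in N2. nra. }
  pose proof (Rabs_triang I1 I2). nra.
Qed.

(** The bound [e * (w + h) ^ 2] is stable under bisection: each of the four quarters carries a
    quarter of it. Then [e] is arbitrary. *)
Lemma goursat : boundary_integral A B x y (x + w) (y + h) = 0.
Proof.
  assert (pos : forall n, 0 < 2 ^ n) by (intros; apply pow_lt; lra).
  assert (inv : forall n, 0 < / 2 ^ n) by (intros; apply Rinv_0_lt_compat; auto).
  assert (bnd : forall e, 0 < e ->
     Rabs (boundary_integral A B x y (x + w) (y + h)) <= e * (w + h) ^ 2).
  { intros e He.
    assert (H := rectangle_induction (fun n a b =>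
       x <= a -> a + w / 2 ^ n <= x + w -> y <= b -> b + h / 2 ^ n <= y + h ->
       Rabs (boundary_integral A B a b (a + w / 2 ^ n) (b + h / 2 ^ n))
         <= e * (w / 2 ^ n + h / 2 ^ n) ^ 2) x y w h Hw Hh).
    simpl in H. replace (w / 1) with w in H by field. replace (h / 1) with h in H by field.
    simpl. apply H; try lra; clear H.
    - intros n a b H1 H2 H3 H4 Ha Ha' Hb Hb'.
      specialize (inv n). specialize (pos n).
      replace (w / 2 ^ n) with (w / (2 * 2 ^ n) + w / (2 * 2 ^ n)) in * by (field; lra).
      replace (h / 2 ^ n) with (h / (2 * 2 ^ n) + h / (2 * 2 ^ n)) in * by (field; lra).
      assert (0 < / (2 * 2 ^ n)) by (apply Rinv_0_lt_compat; lra).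
      assert (0 <= w / (2 * 2 ^ n)) by (apply Rmult_le_pos; lra).
      assert (0 <= h / (2 * 2 ^ n)) by (apply Rmult_le_pos; lra).
      set (w' := w / (2 * 2 ^ n)) in *. set (h' := h / (2 * 2 ^ n)) in *.
      rewrite (boundary_integral_subdivide a b (a + w') (b + h')) by lra.
      specialize (H1 ltac:(lra) ltac:(lra) ltac:(lra) ltac:(lra)).
      specialize (H2 ltac:(lra) ltac:(lra) ltac:(lra) ltac:(lra)).
      specialize (H3 ltac:(lra) ltac:(lra) ltac:(lra) ltac:(lra)).
      specialize (H4 ltac:(lra) ltac:(lra) ltac:(lra) ltac:(lra)).
      rewrite !Rplus_assoc in *.
      eapply Rle_trans; [apply Rabs_triang|].
      eapply Rle_trans; [apply Rplus_le_compat_l; apply Rabs_triang|].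
      eapply Rle_trans; [apply Rplus_le_compat_l, Rplus_le_compat_l; apply Rabs_triang|].
      lra.
    - intros p q Hp Hq.
      destruct (boundary_integral_small p q e He Hp Hq) as [d [Hd H]].
      exists d. split; auto. intros n a b Hn1 Hn2 Ha Hpa Ha' Hb Hqb Hb' _ _ _ _.
      apply H; auto; split; auto; apply Rmult_le_pos; auto; left; apply inv. }
  destruct (Req_dec (boundary_integral A B x y (x + w) (y + h)) 0) as [E|N]; auto.
  apply Rabs_pos_lt in N. set (J := Rabs _) in *.
  pose proof (pow2_ge_0 (w + h)) as H2.
  (* This [e] yields [J <= J / 2]; the [+ 1] covers a rectangle reduced to a point. *)
  specialize (bnd (J / 2 / ((w + h) ^ 2 + 1))).
  assert (0 < J / 2 / ((w + h) ^ 2 + 1)) by (apply Rdiv_lt_0_compat; lra).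
  specialize (bnd H).
  assert (J / 2 / ((w + h) ^ 2 + 1) * ((w + h)^2 + 1) = J / 2) by (field; lra).
  nra.
Qed.
End goursat.

(** * The mean value property *)

Lemma Cmod_pair_le (a b : R) : Cmod (a, b) <= 2 * Rmax (Rabs a) (Rabs b).
Proof.
  eapply Rle_trans; [apply Cmod_2Rmax|]. simpl. apply Rmult_le_compat_r.
  - apply Rle_trans with (Rabs a); [apply Rabs_pos|apply Rmax_l].
  - apply Rsqr_incr_0_var; [|lra]. rewrite Rsqr_sqrt; unfold Rsqr; lra.
Qed.

Lemma im_le_Cmod (z : C) : Rabs (Im z) <= Cmod z.
Proof. eapply Rle_trans; [apply Rmax_r|apply Rmax_Cmod]. Qed.

(** The Cauchy-Riemann equations: the real differential of [F] is multiplication by [l]. *)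
Lemma cder_differentiable (F : C -> C) (x y : R) (l : C) : cder F (x, y) l ->
  differentiable_pt_lim (fun u v => Re (F (u, v))) x y (Re l) (- Im l) /\
  differentiable_pt_lim (fun u v => Im (F (u, v))) x y (Im l) (Re l).
Proof.
  intros [q [Hq [Hl E]]].
  assert (H : forall eps : posreal, locally_2d (fun u v =>
     Cmod (F (u, v) - F (x, y) - l * ((u - x)%R, (v - y)%R))
       <= eps * Rmax (Rabs (u - x)) (Rabs (v - y))) x y).
  { intros eps. destruct (Hq (eps / 2)) as [d [Hd H]]; [pose proof (cond_pos eps); lra|].
    assert (Hd2 : 0 < d / 2) by lra. exists (mkposreal _ Hd2). simpl.
    intros u v Hu Hv. rewrite (E (u, v)).
    replace (F (x, y) + q (u, v) * ((u, v) - (x, y)) - F (x, y) - l * ((u - x)%R, (v - y)%R))%C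
      with ((q (u, v) - q (x, y)) * ((u - x)%R, (v - y)%R))%C
      by (rewrite Hl; change ((u - x)%R, (v - y)%R) with ((u, v) - (x, y))%C; ring).
    rewrite Cmod_mult. pose proof (Cmod_pair_le (u - x) (v - y)) as Hb.
    assert (Rmax (Rabs (u - x)) (Rabs (v - y)) < d / 2) by (apply Rmax_lub_lt; auto).
    specialize (H (u, v)). change ((u, v) - (x, y))%C with ((u - x)%R, (v - y)%R) in H.
    specialize (H ltac:(lra)).
    pose proof (Cmod_ge_0 ((u - x)%R, (v - y)%R)). pose proof (Cmod_ge_0 (q (u, v) - q (x, y))).
    pose proof (cond_pos eps).
    apply Rle_trans with (eps / 2 * (2 * Rmax (Rabs (u - x)) (Rabs (v - y)))); [|lra].
    apply Rmult_le_compat; lra. }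
  split; intros eps; destruct (H eps) as [d Hd]; exists d; intros u v Hu Hv;
    (eapply Rle_trans; [|apply Hd; auto]).
  - eapply Rle_trans; [|apply re_le_Cmod]. right. f_equal.
    unfold Re, Im, Cminus, Cplus, Copp, Cmult; simpl. ring.
  - eapply Rle_trans; [|apply im_le_Cmod]. right. f_equal.
    unfold Re, Im, Cminus, Cplus, Copp, Cmult; simpl. ring.
Qed.

Lemma differentiable_pt_lim_mult (x y : R) :
  differentiable_pt_lim (fun u v => u * v) x y y x.
Proof.
  intros eps. exists eps. intros u v Hu Hv.
  replace (u * v - x * y - (y * (u - x) + x * (v - y))) with ((u - x) * (v - y)) by ring.
  rewrite Rabs_mult. pose proof (Rmax_r (Rabs (u - x)) (Rabs (v - y))).
  pose proof (Rabs_pos (u - x)). pose proof (Rabs_pos (v - y)).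
  apply Rmult_le_compat; lra.
Qed.

Lemma differentiable_pt_lim_snd (f : R -> R) (x y l : R) :
  derivable_pt_lim f y l -> differentiable_pt_lim (fun _ v => f v) x y 0 l.
Proof.
  intros H. cut (differentiable_pt_lim (fun _ v => f v) x y (l * 0 + 0 * 0) (l * 1 + 0 * 0)).
  { replace (l * 0 + 0 * 0) with 0 by ring. replace (l * 1 + 0 * 0) with l by ring. auto. }
  apply (differentiable_pt_lim_comp (fun u _ => f u) (fun _ v => v) (fun _ _ => 0)).
  - apply differentiable_pt_lim_proj1_0. auto.
  - intros eps. exists eps. intros u v _ _. rewrite Rmult_0_l, Rmult_1_l, Rplus_0_l.
    rewrite Rminus_diag. rewrite Rabs_R0. apply Rmult_le_pos. left; apply cond_pos.
    eapply Rle_trans; [apply Rabs_pos|apply Rmax_l].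
  - apply (differentiable_pt_lim_proj1_0 (fun _ => 0)). apply derivable_pt_lim_const.
Qed.

(** Both coordinates of [circle_point] have this form, with [f] the cosine or the sine. *)
Lemma differentiable_pt_lim_affine_prod (c x y l : R) (f : R -> R) :
  derivable_pt_lim f y l ->
  differentiable_pt_lim (fun u v => c + u * f v) x y (f y) (x * l).
Proof.
  intros H.
  replace (f y) with (1 * (f y * 1 + x * 0) + 0 * 0) by ring.
  replace (x * l) with (1 * (f y * 0 + x * l) + 0 * 0) by ring.
  apply (differentiable_pt_lim_comp (fun u _ => c + u) (fun u v => u * f v) (fun _ _ => 0)).
  - apply (differentiable_pt_lim_proj1_0 (fun u => c + u)).
    replace 1 with (0 + 1) by ring.
    apply (derivable_pt_lim_plus (fun _ => c) (fun u => u)).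
    apply derivable_pt_lim_const. apply derivable_pt_lim_id.
  - apply (differentiable_pt_lim_comp (fun u v => u * v) (fun u _ => u) (fun _ v => f v)).
    + apply differentiable_pt_lim_mult.
    + apply (differentiable_pt_lim_proj1_0 (fun u => u)). apply derivable_pt_lim_id.
    + apply differentiable_pt_lim_snd. auto.
  - apply (differentiable_pt_lim_proj1_0 (fun _ => 0)). apply derivable_pt_lim_const.
Qed.

Definition circle_point (z : C) (r t : R) : C := (fst z + r * cos t, snd z + r * sin t).

Lemma Cmod_circle_point (z : C) (r t : R) : 0 <= r -> Cmod (circle_point z r t - z) = r.
Proof.
  intros Hr. unfold Cmod, circle_point. simpl.
  replace (_ + _) with (r * r * (Rsqr (sin t) + Rsqr (cos t))) by (unfold Rsqr; ring).
  rewrite sin2_cos2, Rmult_1_r. apply sqrt_square. auto.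
Qed.

(** The Cauchy-Riemann equations in polar coordinates. The derivative of [Im F] in [t] is [r] times
    that of [Re F] in [r], which is the closedness of [Im F dr / r + Re F dt]. *)
Lemma cder_polar (F : C -> C) (z l : C) (r t : R) : cder F (circle_point z r t) l ->
  differentiable_pt_lim (fun u v => Re (F (circle_point z u v))) r t
    (Re l * cos t - Im l * sin t) (- r * (Re l * sin t + Im l * cos t)) /\
  differentiable_pt_lim (fun u v => Im (F (circle_point z u v))) r t
    (Im l * cos t + Re l * sin t) (r * (Re l * cos t - Im l * sin t)).
Proof.
  intros H. apply cder_differentiable in H. destruct H as [H1 H2].
  pose proof (differentiable_pt_lim_affine_prod (fst z) r t _ cos (derivable_pt_lim_cos t)) as Hc.
  pose proof (differentiable_pt_lim_affine_prod (snd z) r t _ sin (derivable_pt_lim_sin t)) as Hs.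
  split.
  - replace (Re l * cos t - Im l * sin t) with (Re l * cos t + - Im l * sin t) by ring.
    replace (- r * (Re l * sin t + Im l * cos t))
      with (Re l * (r * - sin t) + - Im l * (r * cos t)) by ring.
    exact (differentiable_pt_lim_comp _ _ _ _ _ _ _ _ _ _ _ H1 Hc Hs).
  - replace (r * (Re l * cos t - Im l * sin t))
      with (Im l * (r * - sin t) + Re l * (r * cos t)) by ring.
    exact (differentiable_pt_lim_comp _ _ _ _ _ _ _ _ _ _ _ H2 Hc Hs).
Qed.

Lemma ex_RInt_circle (F : C -> C) (z : C) (r : R) :
  (forall t, cdiff F (circle_point z r t)) ->
  ex_RInt (fun t => Re (F (circle_point z r t))) 0 (2 * PI).
Proof.
  intros H. apply (ex_RInt_continuous (V := R_CompleteNormedModule)).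
  intros t _. destruct (H t) as [l Hl]. apply cder_polar in Hl. destruct Hl as [Hl _].
  exact (differentiable_pt_lim_cont_y _ _ _ _ _ Hl).
Qed.

(** The form is [Im (F dz / z)] in polar coordinates, i.e. [Im F dr / r + Re F dt]. *)
Lemma circle_integral_const (F : C -> C) (z : C) (s r : R) : 0 < s <= r ->
  (forall x, s <= Cmod (x - z) <= r -> cdiff F x) ->
  RInt (fun t => Re (F (circle_point z s t))) 0 (2 * PI) =
  RInt (fun t => Re (F (circle_point z r t))) 0 (2 * PI).
Proof.
  intros Hs HF. pose proof PI_RGT_0.
  set (A := fun u t => Im (F (circle_point z u t)) * / u).
  set (B := fun u t => Re (F (circle_point z u t))).
  assert (G : boundary_integral A B s 0 (s + (r - s)) (0 + 2 * PI) = 0).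
  { apply goursat; try lra. intros p q Hp Hq.
    destruct (HF (circle_point z p q)) as [l Hl]; [rewrite Cmod_circle_point; lra|].
    apply cder_polar in Hl. destruct Hl as [H1 H2].
    exists (/ p * (Im l * cos q + Re l * sin q) +
        Im (F (circle_point z p q)) * (- 1 / (p * p))),
      (Re l * cos q - Im l * sin q), (- p * (Re l * sin q + Im l * cos q)).
    split; [|exact H1].
    replace (Re l * cos q - Im l * sin q) with
      (/ p * (p * (Re l * cos q - Im l * sin q)) + Im (F (circle_point z p q)) * 0) by (field; lra).
    apply (differentiable_pt_lim_comp (fun u v => u * v)
       (fun u v => Im (F (circle_point z u v))) (fun u _ => / u)); auto.
    - apply differentiable_pt_lim_mult.
    - apply differentiable_pt_lim_proj1_0. apply is_derive_Reals.
      auto_derive; [lra|field; lra]. }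
  unfold boundary_integral in G.
  replace (s + (r - s)) with r in G by ring. rewrite Rplus_0_l in G.
  (* By periodicity the sides [t = 0] and [t = 2 * PI] cancel, leaving the two circles. *)
  rewrite (RInt_ext (fun x => A x (2 * PI)) (fun x => A x 0)) in G.
  - unfold A at 1 2 in G. fold (B s) (B r) in G |- *.
    change (RInt (B s) 0 (2 * PI) = RInt (B r) 0 (2 * PI)). unfold B in *. lra.
  - intros x _. unfold A, circle_point. rewrite cos_2PI, sin_2PI, cos_0, sin_0. reflexivity.
Qed.

(** The circle integral does not depend on the radius, and continuity at the centre identifies its
    limit as the radius tends to 0. The centre can therefore be an exceptional point. *)
Lemma mean_value (F : C -> C) (z : C) (R0 r : R) : 0 < r < R0 ->
  (forall x, 0 < Cmod (x - z) < R0 -> cdiff F x) -> ccont F z ->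
  RInt (fun t => Re (F (circle_point z r t))) 0 (2 * PI) = 2 * PI * Re (F z).
Proof.
  intros Hr HF HC. pose proof PI_RGT_0 as HPI.
  apply Rminus_diag_uniq. apply NNPP. intros N.
  apply Rabs_pos_lt in N. set (e := Rabs _) in N.
  (* Integrated over a length [2 * PI], this deviation gives [e <= e / 2]. *)
  destruct (HC (e / (4 * PI))) as [d [Hd H]]. { apply Rdiv_lt_0_compat; lra. }
  set (s := Rmin r (d / 2)).
  assert (Hs : 0 < s) by (apply Rmin_pos; lra).
  pose proof (Rmin_l r (d / 2)). pose proof (Rmin_r r (d / 2)). fold s in H0, H1.
  assert (E : e <= (2 * PI - 0) * (e / (4 * PI))).
  { unfold e at 1. rewrite <- (circle_integral_const F z s r); [|lra|intros x Hx; apply HF; lra].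
    assert (X : ex_RInt (fun t => Re (F (circle_point z s t))) 0 (2 * PI)).
    { apply ex_RInt_circle. intros t. apply HF. rewrite Cmod_circle_point; lra. }
    replace (2 * PI * Re (F z)) with (RInt (fun _ => Re (F z)) 0 (2 * PI)).
    2:{ rewrite RInt_const. unfold scal; simpl. unfold mult; simpl. ring. }
    rewrite <- (RInt_minus (V := R_CompleteNormedModule)) by (auto; apply ex_RInt_const).
    apply abs_RInt_le_const; [lra| |].
    - apply (ex_RInt_minus (V := R_CompleteNormedModule)); auto. apply ex_RInt_const.
    - intros t _. left. eapply Rle_lt_trans; [|apply (H (circle_point z s t))].
      + apply (re_le_Cmod (F (circle_point z s t) - F z)).
      + rewrite Cmod_circle_point; lra. }
  replace ((2 * PI - 0) * (e / (4 * PI))) with (e / 2) in E by (field; lra). lra.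
Qed.

(** * The maximum principle, the Schwarz lemma and injective maps *)

(** The Heine-Borel argument, by bisection of the square of side [2 * M] about 0. Local bounds are
    required at all points of the plane; at points outside [K] they express closedness. *)
Lemma compact_bounded_above (K : C -> Prop) (u : C -> R) (M : R) :
  (forall z, K z -> Cmod z <= M) ->
  (forall z, exists d B, 0 < d /\ forall x, K x -> Cmod (x - z) < d -> u x <= B) ->
  exists B, forall x, K x -> u x <= B.
Proof.
  intros HM Hloc. destruct (classic (exists z, K z)) as [[z0 Hz0]|N].
  2:{ exists 0. intros x Hx. elim N. exists x; auto. }
  assert (HM0 : 0 <= M).
  { apply Rle_trans with (Cmod z0); auto. apply Cmod_ge_0. }
  set (P := fun n a b => exists B, forall x, K x ->
     a <= Re x <= a + 2 * M / 2 ^ n -> b <= Im x <= b + 2 * M / 2 ^ n -> u x <= B).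
  assert (H : P 0%nat (- M) (- M)).
  { apply (rectangle_induction P (- M) (- M) (2 * M) (2 * M)); try lra; unfold P.
    - intros n a b [B1 H1] [B2 H2] [B3 H3] [B4 H4].
      assert (E : 2 * M / 2 ^ n = 2 * M / 2 ^ S n + 2 * M / 2 ^ S n).
      { assert (0 < 2 ^ n) by (apply pow_lt; lra). simpl. field. lra. }
      exists (Rmax (Rmax B1 B2) (Rmax B3 B4)). intros x Kx Hx Hy.
      pose proof (Rmax_l (Rmax B1 B2) (Rmax B3 B4)).
      pose proof (Rmax_r (Rmax B1 B2) (Rmax B3 B4)).
      pose proof (Rmax_l B1 B2). pose proof (Rmax_r B1 B2).
      pose proof (Rmax_l B3 B4). pose proof (Rmax_r B3 B4).
      destruct (Rle_lt_dec (Re x) (a + 2 * M / 2 ^ S n));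
      destruct (Rle_lt_dec (Im x) (b + 2 * M / 2 ^ S n)).
      + specialize (H1 x Kx ltac:(lra) ltac:(lra)). lra.
      + specialize (H3 x Kx ltac:(lra) ltac:(lra)). lra.
      + specialize (H2 x Kx ltac:(lra) ltac:(lra)). lra.
      + specialize (H4 x Kx ltac:(lra) ltac:(lra)). lra.
    - intros p q _ _. destruct (Hloc (p, q)) as [d [B [Hd H]]].
      exists (d / 2). split; [lra|].
      intros n a b Hn _ _ Hp _ _ Hq _. exists B. intros x Kx Hx Hy.
      apply H; auto. destruct x as [x1 x2]. simpl in Hx, Hy.
      change ((x1, x2) - (p, q))%C with ((x1 - p)%R, (x2 - q)%R).
      eapply Rle_lt_trans; [apply Cmod_pair_le|].
      assert (Rmax (Rabs (x1 - p)) (Rabs (x2 - q)) < d / 2); [|lra].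
      apply Rmax_lub_lt; apply Rabs_def1; lra. }
  destruct H as [B HB]. exists B. intros x Kx. apply HB; auto; simpl.
  - pose proof (re_le_Cmod x). specialize (HM x Kx).
    assert (Rabs (Re x) <= M) by lra. apply Rabs_le_between in H0. lra.
  - pose proof (im_le_Cmod x). specialize (HM x Kx).
    assert (Rabs (Im x) <= M) by lra. apply Rabs_le_between in H0. lra.
Qed.

Lemma compact_max (K : C -> Prop) (u : C -> R) (M : R) :
  (exists z, K z) -> (forall z, K z -> Cmod z <= M) ->
  (forall z, ~ K z -> exists d, 0 < d /\ forall x, Cmod (x - z) < d -> ~ K x) ->
  (forall z, K z -> forall e, 0 < e -> exists d, 0 < d /\
     forall x, K x -> Cmod (x - z) < d -> Rabs (u x - u z) < e) ->
  exists z, K z /\ forall x, K x -> u x <= u z.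
Proof.
  intros [z0 Hz0] HM Hcl Hu.
  destruct (compact_bounded_above K u M HM) as [B HB].
  { intros z. destruct (classic (K z)) as [Kz|N].
    - destruct (Hu z Kz 1 ltac:(lra)) as [d [Hd H]]. exists d, (u z + 1). split; auto.
      intros x Kx Hx. specialize (H x Kx Hx). apply Rabs_def2 in H. lra.
    - destruct (Hcl z N) as [d [Hd H]]. exists d, 0. split; auto.
      intros x Kx Hx. elim (H x Hx Kx). }
  destruct (completeness (fun y => exists x, K x /\ y = u x)) as [s [Hs1 Hs2]].
  { exists B. intros y [x [Kx ->]]. auto. }
  { exists (u z0), z0. auto. }
  assert (Hle : forall x, K x -> u x <= s) by (intros x Kx; apply Hs1; exists x; auto).
  destruct (classic (exists z, K z /\ u z = s)) as [[z [Kz E]]|N].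
  { exists z. split; auto. intros x Kx. rewrite E. auto. }
  assert (Hlt : forall x, K x -> u x < s).
  { intros x Kx. destruct (Hle x Kx) as [L|E]; auto. elim N. exists x; auto. }
  (* [1 / (s - u)] is locally bounded but cannot be bounded *)
  destruct (compact_bounded_above K (fun x => / (s - u x)) M HM) as [B' HB'].
  { intros z. destruct (classic (K z)) as [Kz|Nz].
    - specialize (Hlt z Kz).
      destruct (Hu z Kz ((s - u z) / 2) ltac:(lra)) as [d [Hd H]].
      exists d, (/ ((s - u z) / 2)). split; auto.
      intros x Kx Hx. specialize (H x Kx Hx). apply Rabs_def2 in H.
      apply Rinv_le_contravar; lra.
    - destruct (Hcl z Nz) as [d [Hd H]]. exists d, 0. split; auto.
      intros x Kx Hx. elim (H x Hx Kx). }
  assert (HBp : 0 < B').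
  { eapply Rlt_le_trans; [|apply (HB' z0 Hz0)]. apply Rinv_0_lt_compat.
    specialize (Hlt z0 Hz0). lra. }
  assert (L : s <= s - / B').
  { apply Hs2. intros y [x [Kx ->]]. specialize (HB' x Kx). specialize (Hlt x Kx).
    apply Rinv_le_contravar in HB'; [|apply Rinv_0_lt_compat; lra].
    rewrite Rinv_inv in HB'. lra. }
  assert (0 < / B') by (apply Rinv_0_lt_compat; auto). lra.
Qed.

Lemma disk_compl_open (p : C) (r : R) (z : C) : ~ Cmod (z - p) <= r ->
  exists d, 0 < d /\ forall x, Cmod (x - z) < d -> ~ Cmod (x - p) <= r.
Proof.
  intros H. exists (Cmod (z - p) - r). split; [lra|]. intros x Hx.
  pose proof (Cmod_sub_triangle z x p). rewrite (Cmod_sub_sym z x) in H0. lra.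
Qed.

Lemma circle_compl_open (p : C) (r : R) (z : C) : Cmod (z - p) <> r ->
  exists d, 0 < d /\ forall x, Cmod (x - z) < d -> Cmod (x - p) <> r.
Proof.
  intros H. exists (Rabs (Cmod (z - p) - r)). split; [apply Rabs_pos_lt; lra|]. intros x Hx E.
  pose proof (Cmod_sub_triangle z x p) as T1. rewrite (Cmod_sub_sym z x) in T1.
  pose proof (Cmod_sub_triangle x z p) as T2.
  assert (Rabs (Cmod (z - p) - r) <= Cmod (x - z)) by (apply Rabs_le; lra). lra.
Qed.

Lemma ccont_Cmod_sq (F : C -> C) (z : C) : ccont F z -> forall e, 0 < e -> exists d, 0 < d /\
  forall x, Cmod (x - z) < d -> Rabs (Cmod (F x) ^ 2 - Cmod (F z) ^ 2) < e.
Proof.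
  intros HF e He.
  assert (H : ccont (fun x => RtoC (Cmod (F x))) z).
  { intros e' He'. destruct (HF e' He') as [d [Hd H]]. exists d. split; auto.
    intros x Hx. eapply Rle_lt_trans; [|apply (H x Hx)].
    rewrite <- RtoC_minus, Cmod_R. apply Rabs_le.
    pose proof (Cmod_le_add_sub (F x) (F z)). pose proof (Cmod_le_add_sub (F z) (F x)).
    rewrite (Cmod_sub_sym (F z)) in H1. lra. }
  destruct (ccont_mult _ _ _ H H e He) as [d [Hd H']]. exists d. split; auto.
  intros x Hx. specialize (H' x Hx).
  rewrite <- !RtoC_mult, <- RtoC_minus, Cmod_R in H'. simpl. rewrite !Rmult_1_r. exact H'.
Qed.

(** The strictly subharmonic function [|F|^2 + eps |z - p|^2] has no interior maximum:
    it lies above [2 Re (conj (F c) F) - |F c|^2 + eps |z - p|^2], whose mean over a circle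
    of radius [s] about [c] exceeds the value of [|F|^2 + eps |z - p|^2] at [c] by [eps s^2]. *)
Lemma no_interior_max (F : C -> C) (c p : C) (R0 e : R) : 0 < R0 -> 0 < e ->
  (forall x, 0 < Cmod (x - c) < R0 -> cdiff F x) -> ccont F c ->
  ~ (forall x, Cmod (x - c) < R0 ->
       Cmod (F x) ^ 2 + e * Cmod (x - p) ^ 2 <= Cmod (F c) ^ 2 + e * Cmod (c - p) ^ 2).
Proof.
  intros HR He HF HC Hmax. pose proof PI_RGT_0 as HPI.
  set (s := R0 / 2). assert (Hs : 0 < s < R0) by (unfold s; lra).
  (* [2 Re G] differs from the minorant described above by a constant and [e |x - c|^2], so the mean
     value property of [G] computes the mean of the minorant. *)
  set (G := fun x => (Cconj (F c) * F x + RtoC e * (Cconj (c - p) * (x + - c)))%C).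
  assert (HG : forall x, cdiff F x -> cdiff G x).
  { intros x Hx. unfold G. apply cdiff_plus.
    - apply cdiff_mult; auto. apply cdiff_const.
    - apply cdiff_mult. apply cdiff_const. apply cdiff_mult. apply cdiff_const.
      apply cdiff_plus. apply cdiff_id. apply cdiff_const. }
  assert (HGc : ccont G c).
  { unfold G. apply ccont_plus.
    - apply ccont_mult; auto. apply ccont_const.
    - apply ccont_mult. apply ccont_const. apply ccont_mult. apply ccont_const.
      apply ccont_plus. apply ccont_id. apply ccont_const. }
  pose proof (mean_value G c R0 s Hs (fun x Hx => HG x (HF x Hx)) HGc) as MV.
  assert (Gc : Re (G c) = Cmod (F c) ^ 2).
  { rewrite Cmod2_alt. unfold G. destruct (F c), c, p. unfold Re, Im. simpl. ring. }
  assert (ub : forall t, Re (G (circle_point c s t)) <= Cmod (F c) ^ 2 - e * s ^ 2 / 2).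
  { intros t. set (x := circle_point c s t).
    assert (Hx : Cmod (x - c) = s) by (apply Cmod_circle_point; lra).
    specialize (Hmax x ltac:(lra)).
    (* This is [|F x - F c|^2 >= 0] expanded. *)
    assert (E1 : 2 * Re (Cconj (F c) * F x) <= Cmod (F x) ^ 2 + Cmod (F c) ^ 2).
    { rewrite !Cmod2_alt. destruct (F c) as [a1 a2], (F x) as [b1 b2]. unfold Re, Im; simpl.
      pose proof (pow2_ge_0 (a1 - b1)). pose proof (pow2_ge_0 (a2 - b2)). nra. }
    assert (E2 : Cmod (x - p) ^ 2 = Cmod (c - p) ^ 2 + s ^ 2 + 2 * Re (Cconj (c - p) * (x - c))).
    { rewrite <- Hx, !Cmod2_alt. destruct x, c, p. unfold Re, Im. simpl. ring. }
    assert (E3 : Re (G x) = Re (Cconj (F c) * F x) + e * Re (Cconj (c - p) * (x - c))).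
    { unfold G, Re. simpl. ring. }
    rewrite E2 in Hmax. rewrite E3. nra. }
  assert (L : RInt (fun t => Re (G (circle_point c s t))) 0 (2 * PI)
      <= RInt (fun _ => Cmod (F c) ^ 2 - e * s ^ 2 / 2) 0 (2 * PI)).
  { apply RInt_le; [lra| |apply ex_RInt_const|intros; apply ub].
    apply ex_RInt_circle. intros t. apply HG, HF. rewrite Cmod_circle_point; lra. }
  rewrite MV, Gc, RInt_const in L. unfold scal in L; simpl in L. unfold mult in L; simpl in L.
  assert (0 < e * (s * s)) by (apply Rmult_lt_0_compat; nra). nra.
Qed.

(** If [|F x0| > m], a small multiple of [|x - p|^2] can be added to [|F|^2] so that the value at
    [x0] still exceeds all boundary values. The maximum of the sum is then attained inside, against
    [no_interior_max]. *)
Lemma max_modulus (F : C -> C) (p q : C) (r m : R) : 0 <= r ->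
  (forall x, Cmod (x - p) <= r -> ccont F x) ->
  (forall x, Cmod (x - p) < r -> x <> q -> cdiff F x) ->
  (forall x, Cmod (x - p) = r -> Cmod (F x) <= m) ->
  forall x, Cmod (x - p) <= r -> Cmod (F x) <= m.
Proof.
  intros Hr HC HF Hm x0 Hx0. apply Rnot_lt_le. intros Hlt.
  assert (Hm0 : 0 <= m).
  { eapply Rle_trans; [apply Cmod_ge_0|apply (Hm (circle_point p r 0))].
    apply Cmod_circle_point. auto. }
  (* The perturbation [e * r ^ 2] on the boundary stays below half of the gap. *)
  set (e := (Cmod (F x0) ^ 2 - m ^ 2) / 2 / (r ^ 2 + 1)).
  pose proof (pow2_ge_0 r) as Hr2.
  assert (Hsq : m ^ 2 < Cmod (F x0) ^ 2) by nra.
  assert (He : 0 < e) by (unfold e; apply Rdiv_lt_0_compat; lra).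
  assert (Her : m ^ 2 + e * r ^ 2 < Cmod (F x0) ^ 2).
  { assert (E : e * (r ^ 2 + 1) = (Cmod (F x0) ^ 2 - m ^ 2) / 2) by (unfold e; field; lra). nra. }
  destruct (compact_max (fun x => Cmod (x - p) <= r)
     (fun x => Cmod (F x) ^ 2 + e * Cmod (x - p) ^ 2) (Cmod p + r)) as [c [Hc Hmax]].
  - exists x0; auto.
  - intros z Hz. pose proof (Cmod_le_add_sub z p). lra.
  - apply disk_compl_open.
  - intros z Hz e' He'.
    destruct (ccont_Cmod_sq F z (HC z Hz) (e' / 2) ltac:(lra)) as [d1 [Hd1 H1]].
    destruct (ccont_Cmod_sq (fun x => x - p)%C z) with (e := e' / 2 / e) as [d2 [Hd2 H2]].
    { apply (ccont_plus (fun x => x) (fun _ => (- p)%C)); [apply ccont_id|apply ccont_const]. }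
    { apply Rdiv_lt_0_compat; lra. }
    exists (Rmin d1 d2). split; [apply Rmin_pos; auto|].
    intros x _ Hx. pose proof (Rmin_l d1 d2). pose proof (Rmin_r d1 d2).
    specialize (H1 x ltac:(lra)). specialize (H2 x ltac:(lra)).
    apply Rabs_def2 in H1. apply Rabs_def2 in H2.
    set (X := Cmod (x - p) ^ 2) in *. set (Z := Cmod (z - p) ^ 2) in *.
    assert (e * (X - Z) < e' / 2 /\ - (e' / 2) < e * (X - Z)).
    { assert (E : e * (e' / 2 / e) = e' / 2) by (field; lra).
      split; rewrite <- E; nra. }
    apply Rabs_def1; lra.
  - assert (Hcr : Cmod (c - p) < r).
    { destruct Hc as [L|E]; auto. exfalso. specialize (Hmax x0 Hx0). simpl in Hmax.
      specialize (Hm c E). rewrite E in Hmax.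
      pose proof (Cmod_ge_0 (F c)). pose proof (Cmod_ge_0 (x0 - p)). nra. }
    destruct (classic (c = q)) as [Eq|Nq].
    + apply (no_interior_max F c p (r - Cmod (c - p)) e); auto; try lra.
      * intros x Hx. apply HF.
        -- pose proof (Cmod_sub_triangle x c p). lra.
        -- intros E. subst. rewrite Cmod_sub_diag in Hx. lra.
      * intros x Hx. apply Hmax. pose proof (Cmod_sub_triangle x c p). lra.
    (* When the maximum is not at [q], the radius is capped by the distance to [q], which keeps [q]
       out of the disk around [c]. *)
    + pose proof (Cmod_sub_pos _ _ Nq).
      pose proof (Rmin_l (r - Cmod (c - p)) (Cmod (c - q))).
      pose proof (Rmin_r (r - Cmod (c - p)) (Cmod (c - q))).
      apply (no_interior_max F c p (Rmin (r - Cmod (c - p)) (Cmod (c - q))) e); auto; try lra.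
      * apply Rmin_pos; lra.
      * intros x Hx. apply HF.
        -- pose proof (Cmod_sub_triangle x c p). lra.
        -- intros E. subst. rewrite (Cmod_sub_sym q c) in Hx. lra.
      * intros x Hx. apply Hmax. pose proof (Cmod_sub_triangle x c p). lra.
Qed.

(** The Caratheodory factor [q] of [h] at 0 is the quotient [h z / z], with 0 as its exceptional
    point. It is bounded by [/ r] on the circle of radius [r], hence inside, and [r] tends to 1. *)
Lemma schwarz (h : C -> C) : (forall z, Cmod z < 1 -> cdiff h z /\ Cmod (h z) < 1) ->
  h (RtoC 0) = RtoC 0 -> forall z, Cmod z < 1 -> Cmod (h z) <= Cmod z.
Proof.
  intros Hh H0 z Hz.
  destruct (Hh (RtoC 0)) as [[l [q [Hq [Hl E]]]] _]; [rewrite Cmod_0; lra|].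
  assert (E' : forall x, h x = (q x * x)%C) by (intros x; rewrite (E x), H0; ring).
  assert (Dq : forall x, Cmod x < 1 -> x <> RtoC 0 -> cdiff q x).
  { intros x Hx Nx. apply cdiff_ext_loc with (fun x => h x * / x)%C (Cmod x).
    - apply Cmod_gt_0; auto.
    - intros y Hy. rewrite E'. field. intros ->.
      rewrite Cmod_sub_sym in Hy. replace (x - 0)%C with x in Hy by ring. lra.
    - apply cdiff_mult. apply Hh; auto. apply cdiff_inv; auto. apply cdiff_id. }
  assert (Cq : forall x, Cmod x < 1 -> ccont q x).
  { intros x Hx. destruct (classic (x = RtoC 0)) as [->|N]; auto. apply cdiff_cont; auto. }
  assert (S0 : forall x, (x - 0)%C = x) by (intros; ring).
  assert (bnd : forall r, Cmod z < r -> r < 1 -> Cmod (q z) <= / r).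
  { intros r Hr1 Hr2. pose proof (Cmod_ge_0 z).
    apply (max_modulus q (RtoC 0) (RtoC 0) r); [lra| | | |rewrite S0; lra];
      intros x; rewrite S0; intros Hx.
    - apply Cq. lra.
    - apply Dq. lra.
    - destruct (Hh x ltac:(lra)) as [_ Hx1]. rewrite E', Cmod_mult, Hx in Hx1.
      left. apply Rmult_lt_reg_r with r; [lra|]. rewrite Rinv_l by lra. auto. }
  assert (Hq1 : Cmod (q z) <= 1).
  { apply Rnot_lt_le. intros L. pose proof (Cmod_ge_0 z) as Hz0.
    (* The first entry gives [|z| < r]. The inverse of the second is the midpoint of 1 and [|q z|],
       so [/ r] is smaller than [|q z|]. *)
    set (r := Rmax ((1 + Cmod z) / 2) (2 / (1 + Cmod (q z)))).
    assert (R1 : 2 / (1 + Cmod (q z)) < 1).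
    { apply Rmult_lt_reg_r with (1 + Cmod (q z)); [lra|]. unfold Rdiv.
      rewrite Rmult_assoc, Rinv_l by lra. lra. }
    pose proof (Rmax_l ((1 + Cmod z) / 2) (2 / (1 + Cmod (q z)))).
    pose proof (Rmax_r ((1 + Cmod z) / 2) (2 / (1 + Cmod (q z)))).
    fold r in H, H1.
    assert (Hr : r < 1) by (apply Rmax_lub_lt; lra).
    specialize (bnd r ltac:(lra) Hr).
    assert (B2 : / r <= / (2 / (1 + Cmod (q z)))).
    { apply Rinv_le_contravar; auto. apply Rdiv_lt_0_compat; lra. }
    replace (/ (2 / (1 + Cmod (q z)))) with ((1 + Cmod (q z)) / 2) in B2 by (field; lra).
    lra. }
  rewrite E', Cmod_mult. pose proof (Cmod_ge_0 z). nra.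
Qed.

(** The real mean value theorem is applied along the segment from [z] to [x], separately to the real
    and imaginary parts. *)
Lemma zero_derivative_constant (f : C -> C) (z : C) (R0 : R) :
  (forall x, Cmod (x - z) < R0 -> cder f x 0) ->
  forall x, Cmod (x - z) < R0 -> f x = f z.
Proof.
  intros H x Hx.
  set (g := fun t => (fst z + t * fst (x - z)%C, snd z + t * snd (x - z)%C) : C).
  assert (Eg : forall t, g t = (z + RtoC t * (x - z))%C).
  { intros t. unfold g. destruct z, x. unfold Cplus, Cmult, Cminus, Copp. simpl. f_equal; ring. }
  assert (D : forall t, 0 <= t <= 1 ->
     derivable_pt_lim (fun s => Re (f (g s))) t 0 /\ derivable_pt_lim (fun s => Im (f (g s))) t 0).
  { intros t Ht.
    assert (Hg : Cmod (g t - z) < R0).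
    { rewrite Eg. replace (z + t * (x - z) - z)%C with (t * (x - z))%C by ring.
      rewrite Cmod_mult, Cmod_R, Rabs_pos_eq by lra. pose proof (Cmod_ge_0 (x - z)). nra. }
    destruct (cder_differentiable _ _ _ _ (H _ Hg)) as [D1 D2]. simpl in D1, D2.
    rewrite Ropp_0 in D1.
    assert (L : forall a b, derivable_pt_lim (fun s => a + s * b) t b).
    { intros a b. apply is_derive_Reals. auto_derive; auto. ring. }
    pose proof (derivable_pt_lim_comp_2d _ _ _ _ _ _ _ _ D1 (L _ _) (L _ _)) as E1.
    pose proof (derivable_pt_lim_comp_2d _ _ _ _ _ _ _ _ D2 (L _ _) (L _ _)) as E2.
    rewrite !Rmult_0_l, Rplus_0_l in E1. rewrite !Rmult_0_l, Rplus_0_l in E2. auto. }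
  destruct (MVT_cor2 (fun s => Re (f (g s))) (fun _ => 0) 0 1 ltac:(lra)) as [c1 [F1 _]].
  { intros; apply D; auto. }
  destruct (MVT_cor2 (fun s => Im (f (g s))) (fun _ => 0) 0 1 ltac:(lra)) as [c2 [F2 _]].
  { intros; apply D; auto. }
  replace (g 1) with x in * by (rewrite Eg; ring).
  replace (g 0) with z in * by (rewrite Eg; ring).
  destruct (f x), (f z). unfold Re, Im in *. simpl in *. f_equal; lra.
Qed.

(** Hurwitz-type argument: for [a] near [z] with [f' a <> 0] the function
    [(x - a) / (f x - f a)] extends continuously to [a], so the maximum principle bounds its value
    at [z] by its values on a circle, uniformly in [a]. Such points [a] accumulate at [z]. *)
Lemma injective_derivative_neq_0 (f : C -> C) (z l : C) (R0 : R) : 0 < R0 ->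
  (forall x, Cmod (x - z) < R0 -> cdiff f x) ->
  (forall x y, Cmod (x - z) < R0 -> Cmod (y - z) < R0 -> f x = f y -> x = y) ->
  cder f z l -> l <> RtoC 0.
Proof.
  intros HR Hf Hinj Hl El. subst l.
  set (r := R0 / 2). assert (Hr : 0 < r < R0) by (unfold r; lra).
  (* [c] minimizes [|f x - f z|] on the circle; injectivity makes the minimum [del] positive. *)
  destruct (compact_max (fun x => Cmod (x - z) = r) (fun x => - Cmod (f x - f z) ^ 2)
     (Cmod z + r)) as [c [Hc Hmax]].
  { exists (circle_point z r 0). apply Cmod_circle_point. lra. }
  { intros x Hx. pose proof (Cmod_le_add_sub x z). lra. }
  { apply circle_compl_open. }
  { intros x Hx e He.
    destruct (ccont_Cmod_sq (fun x => f x - f z)%C x) with (e := e) as [d [Hd H]]; auto.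
    - apply (ccont_plus f (fun _ => (- f z)%C)); [|apply ccont_const].
      apply cdiff_cont, Hf. lra.
    - exists d. split; auto. intros y _ Hy. rewrite <- Rabs_Ropp.
      replace (- _) with (Cmod (f y - f z) ^ 2 - Cmod (f x - f z) ^ 2) by ring. auto. }
  set (del := Cmod (f c - f z)).
  assert (Hdel : 0 < del).
  { apply Cmod_sub_pos. intros E. apply Hinj in E; [|lra|rewrite Cmod_sub_diag; lra].
    subst. rewrite Cmod_sub_diag in Hc. lra. }
  assert (Hmin : forall x, Cmod (x - z) = r -> del <= Cmod (f x - f z)).
  { intros x Hx. specialize (Hmax x Hx). simpl in Hmax. pose proof (Cmod_ge_0 (f x - f z)).
    unfold del in *. nra. }
  clear Hmax.
  assert (Hz : cdiff f z) by (exists (RtoC 0); auto).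
  destruct (cdiff_cont _ _ Hz (del / 2) ltac:(lra)) as [d1 [Hd1 H1]].
  destruct Hl as [q0 [Hq0 [Hl0 E0]]].
  (* For [a] close to [z] and [x] on the circle, [|f x - f a| > del / 2] and [|x - a| <= 2 * r], so
     the quotient is at least [del / (4 * r)] there and, by the maximum principle for its inverse,
     at [z]. But its value at [z] is [q0 a], which is smaller because [f] has derivative 0 at
     [z]. *)
  destruct (Hq0 (del / (4 * r))) as [d2 [Hd2 H2]]; [apply Rdiv_lt_0_compat; lra|].
  set (d := Rmin r (Rmin d1 d2)).
  assert (Hd : 0 < d) by (repeat apply Rmin_pos; lra).
  assert (Hdr : d <= r /\ d <= d1 /\ d <= d2).
  { pose proof (Rmin_l r (Rmin d1 d2)). pose proof (Rmin_r r (Rmin d1 d2)).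
    pose proof (Rmin_l d1 d2). pose proof (Rmin_r d1 d2). unfold d. lra. }
  destruct (classic (exists a la, Cmod (a - z) < d /\ a <> z /\ cder f a la /\ la <> RtoC 0))
    as [[a [la [Ha [Naz [Hla Nla]]]]]|N].
  - destruct Hla as [q [Hq [Hqa E]]].
    assert (Nq : forall x, Cmod (x - z) < R0 -> q x <> RtoC 0).
    { intros x Hx Eq. destruct (classic (x = a)) as [->|Nx]; [congruence|].
      apply Nx. apply Hinj; [lra|lra|]. rewrite (E x), Eq. ring. }
    assert (Eq : forall x, x <> a -> q x = ((f x - f a) * / (x - a))%C).
    { intros x Nx. rewrite (E x). field. apply Cmod_gt_0. apply Cmod_sub_pos. auto. }
    assert (Dq : forall x, Cmod (x - z) < R0 -> x <> a -> cdiff q x).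
    { intros x Hx Nx.
      apply cdiff_ext_loc with (fun x => (f x + - f a) * / (x + - a))%C (Cmod (x - a)).
      - apply Cmod_sub_pos; auto.
      - intros y Hy. symmetry. apply Eq. intros ->. rewrite Cmod_sub_sym in Hy. lra.
      - apply cdiff_mult. apply cdiff_plus; [apply Hf; auto|apply cdiff_const].
        apply cdiff_inv. apply cdiff_plus; [apply cdiff_id|apply cdiff_const].
        apply Cmod_gt_0. apply Cmod_sub_pos; auto. }
    assert (Cq : forall x, Cmod (x - z) < R0 -> ccont q x).
    { intros x Hx. destruct (classic (x = a)) as [->|Nx]; auto. apply cdiff_cont; auto. }
    assert (B : Cmod (/ q z) <= 4 * r / del).
    { apply (max_modulus (fun x => / q x)%C z a r); [lra| | | |rewrite Cmod_sub_diag; lra].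
      - intros x Hx. apply ccont_inv; [apply Cq|apply Nq]; lra.
      - intros x Hx Nx. apply cdiff_inv; [apply Dq; auto|apply Nq]; lra.
      - intros x Hx.
        assert (Nx : x <> a) by (intros ->; lra).
        assert (Hfa : Cmod (f a - f z) < del / 2) by (apply H1; lra).
        assert (Hfx : del / 2 < Cmod (f x - f a)).
        { specialize (Hmin x Hx). pose proof (Cmod_sub_triangle (f x) (f a) (f z)). lra. }
        assert (Hxa : Cmod (x - a) <= 2 * r).
        { pose proof (Cmod_sub_triangle x z a). rewrite (Cmod_sub_sym z a) in H. lra. }
        assert (Cmod (q x) * Cmod (x - a) = Cmod (f x - f a)).
        { rewrite <- Cmod_mult. f_equal. rewrite (E x). ring. }
        pose proof (Cmod_sub_pos _ _ Nx).
        rewrite Cmod_inv by (apply Nq; lra).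
        replace (4 * r / del) with (/ (del / (4 * r))) by (field; lra).
        apply Rinv_le_contravar; [apply Rdiv_lt_0_compat; lra|].
        apply Rmult_le_reg_r with (4 * r); [lra|].
        replace (del / (4 * r) * (4 * r)) with del by (field; lra).
        pose proof (Cmod_ge_0 (q x)). nra. }
    assert (Hqz : q z <> RtoC 0) by (apply Nq; rewrite Cmod_sub_diag; lra).
    assert (Eqz : q z = q0 a).
    { rewrite Eq by auto. rewrite (E0 a). field.
      apply Cmod_gt_0, Cmod_sub_pos. auto. }
    rewrite Cmod_inv in B by auto.
    specialize (H2 a ltac:(lra)). rewrite Hl0 in H2.
    replace (q0 a - 0)%C with (q z) in H2 by (rewrite Eqz; ring).
    assert (0 < Cmod (q z)) by (apply Cmod_gt_0; auto).
    apply Rinv_lt_contravar in H2.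
    + replace (/ (del / (4 * r))) with (4 * r / del) in H2 by (field; lra). lra.
    + apply Rmult_lt_0_compat; auto. apply Rdiv_lt_0_compat; lra.
  (* Otherwise the derivative vanishes on a whole disk and [f] is constant there, against
     injectivity. *)
  - assert (Z : forall x, Cmod (x - z) < d -> cder f x 0).
    { intros x Hx. destruct (classic (x = z)) as [->|Nx]; [exists q0; auto|].
      destruct (Hf x ltac:(lra)) as [m Hm]. destruct (classic (m = RtoC 0)) as [<-|Nm]; auto.
      elim N. exists x, m. auto. }
    set (x := circle_point z (d / 2) 0).
    assert (Hx : Cmod (x - z) = d / 2) by (apply Cmod_circle_point; lra).
    assert (x = z).
    { apply Hinj; [lra|rewrite Cmod_sub_diag; lra|].
      apply (zero_derivative_constant f z d Z). lra. }
    rewrite H, Cmod_sub_diag in Hx. lra.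
Qed.

(** With factors [q] of [p] and [s] of [f], the relation [p (g x) = f x] reads
    [q (g x) * (g x - g z) = s x * (x - z)]. Since [q (g x)] is nonzero near [z], division gives a
    continuous factor for [g]. *)
Lemma cdiff_lift (p f g : C -> C) (z l : C) (d : R) : 0 < d ->
  ccont g z -> cdiff f z -> cder p (g z) l -> l <> RtoC 0 ->
  (forall x, Cmod (x - z) < d -> p (g x) = f x) -> cdiff g z.
Proof.
  intros Hd Hg [m [s [Hs [_ Es]]]] [q [Hq [Hl Eq]]] Nl E.
  assert (Cqg : ccont (fun x => q (g x)) z) by (apply (ccont_comp q g); auto).
  destruct (ccont_nonzero (fun x => q (g x)) z Cqg) as [d' [Hd' H']]; [congruence|].
  exists (s z * / q (g z))%C.
  apply cder_loc with (fun x => s x * / q (g x))%C (Rmin d d'); auto.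
  - apply Rmin_pos; auto.
  - apply ccont_mult; auto. apply ccont_inv; auto. congruence.
  - intros x Hx. pose proof (Rmin_l d d'). pose proof (Rmin_r d d').
    assert (Nx : q (g x) <> RtoC 0).
    { intros Z. specialize (H' x ltac:(lra)). rewrite Z, Cmod_0 in H'.
      pose proof (Cmod_ge_0 (q (g z))). lra. }
    assert (F : (q (g x) * (g x - g z) = s x * (x - z))%C).
    { replace (s x * (x - z))%C with (f x - f z)%C by (rewrite (Es x); ring).
      rewrite <- (E x) by lra. rewrite <- (E z) by (rewrite Cmod_sub_diag; lra).
      rewrite (Eq (g x)). ring. }
    replace (s x * / q (g x) * (x - z))%C with (s x * (x - z) * / q (g x))%C by ring.
    rewrite <- F. field. auto.
Qed.

(** * Lifting along coverings *)

(** At the supremum [m] of the parameters satisfying [E], the local condition transfers [E] from a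
    point just below [m] to one beyond [m], unless [m = 1]. *)
Lemma interval_induction (E : R -> Prop) : E 0 ->
  (forall t, 0 <= t <= 1 -> exists d, 0 < d /\ forall s s', 0 <= s <= 1 -> 0 <= s' <= 1 ->
     Rabs (s - t) < d -> Rabs (s' - t) < d -> E s -> E s') ->
  E 1.
Proof.
  intros H0 Hloc.
  destruct (completeness (fun t => 0 <= t <= 1 /\ E t)) as [m [Hm1 Hm2]].
  { exists 1. intros t [Ht _]. lra. }
  { exists 0. split; auto. lra. }
  assert (Hm : 0 <= m <= 1).
  { split. apply Hm1. split; auto; lra. apply Hm2. intros t [Ht _]. lra. }
  destruct (Hloc m Hm) as [d [Hd H]].
  destruct (classic (exists s, m - d < s /\ 0 <= s <= 1 /\ E s)) as [[s [Hs1 [Hs2 Es]]]|N].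
  - assert (s <= m) by (apply Hm1; auto).
    set (s' := Rmin 1 (m + d / 2)).
    pose proof (Rmin_l 1 (m + d / 2)). pose proof (Rmin_r 1 (m + d / 2)). fold s' in H2, H3.
    assert (m <= s') by (unfold s'; apply Rmin_glb; lra).
    assert (Es' : E s').
    { apply (H s); auto; try lra; apply Rabs_def1; lra. }
    assert (s' <= m) by (apply Hm1; split; auto; lra).
    replace 1 with s'; auto.
    unfold s', Rmin in *. destruct (Rle_dec 1 (m + d / 2)); lra.
  - exfalso. assert (m <= m - d); [|lra].
    apply Hm2. intros t [Ht Et]. apply Rnot_lt_le. intros L. apply N. exists t. auto.
Qed.

Definition convex (W : C -> Prop) : Prop :=
  forall x y t, W x -> W y -> 0 <= t <= 1 -> W (x + RtoC t * (y - x))%C.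

Lemma convex_inter (V W : C -> Prop) : convex V -> convex W -> convex (fun x => V x /\ W x).
Proof. intros HV HW x y t [] [] Ht. split; auto. Qed.

Lemma convex_comb_near (x y p q : C) (t e : R) : 0 <= t <= 1 ->
  Cmod (x - p) < e -> Cmod (y - q) < e ->
  Cmod (x + RtoC t * (y - x) - (p + RtoC t * (q - p))) < e.
Proof.
  intros Ht Hx Hy.
  replace (x + t * (y - x) - (p + t * (q - p)))%C
    with (RtoC (1 - t) * (x - p) + RtoC t * (y - q))%C by (rewrite RtoC_minus; ring).
  eapply Rle_lt_trans; [apply Cmod_triangle|].
  rewrite !Cmod_mult, !Cmod_R, (Rabs_pos_eq (1 - t)), (Rabs_pos_eq t) by lra.
  destruct (Rle_lt_dec t (1 / 2)); nra.
Qed.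

Lemma convex_ball (c : C) (d : R) : convex (fun x => Cmod (x - c) < d).
Proof.
  intros x y t Hx Hy Ht. pose proof (convex_comb_near x y c c t d Ht Hx Hy) as H.
  replace (c + t * (c - c))%C with c in H by ring. exact H.
Qed.

Lemma segment_dist (c w : C) (s t : R) :
  Cmod (c + RtoC s * (w - c) - (c + RtoC t * (w - c))) = Rabs (s - t) * Cmod (w - c).
Proof.
  replace (c + s * (w - c) - (c + t * (w - c)))%C with (RtoC (s - t) * (w - c))%C
    by (rewrite RtoC_minus; ring).
  rewrite Cmod_mult, Cmod_R. reflexivity.
Qed.

Lemma ccont_preimage (g : C -> C) (z : C) (V : C -> Prop) : ccont g z -> open V -> V (g z) ->
  exists d, 0 < d /\ forall x, Cmod (x - z) < d -> V (g x).
Proof.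
  intros Hg HV Hz. destruct (open_Cmod V (g z) HV Hz) as [e [He H]].
  destruct (Hg e He) as [d [Hd H']]. exists d. auto.
Qed.

Lemma covering_sheet (p : C -> C) (A B : C -> Prop) (a : C) : covering_map p A B -> A a ->
  exists V : C -> Prop, open V /\ V a /\ (forall z, V z -> A z) /\
    forall x y, V x -> V y -> p x = p y -> x = y.
Proof.
  intros [H1 [_ H3]] Ha. destruct (H3 (p a)) as [U [HU [Ua [_ [I [V [VO [_ [VA VH]]]]]]]]].
  { apply H1; auto. }
  destruct (proj1 (VA a) (conj Ha Ua)) as [i Hi].
  exists (V i). repeat split; auto.
  - intros z Hz. apply VA. exists i; auto.
  - destruct (VH i) as [_ [s [_ Hs]]]. intros x y Vx Vy E.
    rewrite <- (Hs x Vx), <- (Hs y Vy), E. auto.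
Qed.

(** Two points of one fibre lie on the same sheet, where [p] is injective, or on disjoint sheets.
    Hence the coincidence of two lifts is locally constant, which is what [lift_unique] propagates
    along a segment. *)
Lemma covering_separation (p : C -> C) (A B : C -> Prop) (a b : C) :
  covering_map p A B -> A a -> A b -> p a = p b ->
  exists V W : C -> Prop, open V /\ open W /\ V a /\ W b /\
    forall x y, V x -> W y -> p x = p y -> (x = y <-> a = b).
Proof.
  intros [H1 [_ H3]] Ha Hb Eab. destruct (H3 (p a)) as [U [HU [Ua [_ [I [V [VO [VD [VA VH]]]]]]]]].
  { apply H1; auto. }
  destruct (proj1 (VA a) (conj Ha Ua)) as [i Hi]. rewrite Eab in Ua.
  destruct (proj1 (VA b) (conj Hb Ua)) as [j Hj].
  exists (V i), (V j). repeat split; auto.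
  - intros E. subst y.
    assert (E' : i = j) by (apply (VD i j x); auto). subst j.
    destruct (VH i) as [_ [s [_ Hs]]]. rewrite <- (Hs a Hi), <- (Hs b Hj), Eab. auto.
  - intros E. subst b.
    assert (E' : i = j) by (apply (VD i j a); auto). subst j.
    destruct (VH i) as [_ [s [_ Hs]]]. rewrite <- (Hs x H), <- (Hs y H0), H2. auto.
Qed.

Lemma lift_unique (p g h : C -> C) (A B W : C -> Prop) (c : C) :
  covering_map p A B -> convex W -> W c ->
  (forall z, W z -> ccont g z /\ A (g z)) ->
  (forall z, W z -> ccont h z /\ A (h z)) ->
  (forall z, W z -> p (g z) = p (h z)) -> g c = h c ->
  forall z, W z -> g z = h z.
Proof.
  intros Hp HW Wc Hg Hh E Ec z Wz.
  set (y := fun t => (c + RtoC t * (z - c))%C).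
  cut (g (y 1) = h (y 1)).
  { replace (y 1) with z; auto. unfold y. ring. }
  apply (interval_induction (fun t => g (y t) = h (y t))).
  { replace (y 0) with c; auto. unfold y. ring. }
  intros t Ht. assert (Wt : W (y t)) by (apply HW; auto).
  destruct (Hg _ Wt) as [Cg Ag]. destruct (Hh _ Wt) as [Ch Ah].
  destruct (covering_separation p A B (g (y t)) (h (y t))) as [V [V' [OV [OV' [Vg [Vh H]]]]]]; auto.
  destruct (ccont_preimage g (y t) V Cg OV Vg) as [d1 [Hd1 H1]].
  destruct (ccont_preimage h (y t) V' Ch OV' Vh) as [d2 [Hd2 H2]].
  pose proof (Cmod_ge_0 (z - c)) as Hzc.
  assert (Hd : 0 < Rmin d1 d2) by (apply Rmin_pos; auto).
  (* [y] is Lipschitz with constant [|z - c|]; the [+ 1] covers [z = c]. *)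
  exists (Rmin d1 d2 / (Cmod (z - c) + 1)). split; [apply Rdiv_lt_0_compat; lra|].
  assert (near : forall s, 0 <= s <= 1 -> Rabs (s - t) < Rmin d1 d2 / (Cmod (z - c) + 1) ->
     (g (y s) = h (y s) <-> g (y t) = h (y t))).
  { intros s Hs Hst.
    assert (Hy : Cmod (y s - y t) < Rmin d1 d2).
    { unfold y. rewrite segment_dist.
      apply Rmult_lt_compat_r with (r := Cmod (z - c) + 1) in Hst; [|lra].
      replace (Rmin d1 d2 / (Cmod (z - c) + 1) * (Cmod (z - c) + 1)) with (Rmin d1 d2)
        in Hst by (field; lra).
      pose proof (Rabs_pos (s - t)). nra. }
    pose proof (Rmin_l d1 d2). pose proof (Rmin_r d1 d2).
    apply H; [apply H1; lra|apply H2; lra|]. apply E. apply HW; auto. }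
  intros s s' Hs Hs' Ls Ls'. rewrite (near s Hs Ls), (near s' Hs' Ls'). auto.
Qed.

(** The [e]-neighbourhood of the part of the segment from [c] to [w] up to parameter [t]. It is
    open, so continuity of a lift can be stated in the plane, and convex, so [lift_unique] applies
    to intersections of tubes. *)
Definition tube (c w : C) (t e : R) (x : C) : Prop :=
  exists r, 0 <= r <= t /\ Cmod (x - (c + RtoC r * (w - c))) < e.

Lemma tube_convex (c w : C) (t e : R) : convex (tube c w t e).
Proof.
  intros x y s [r [Hr Lr]] [r' [Hr' Lr']] Hs.
  exists (r + s * (r' - r)). split; [nra|].
  pose proof (convex_comb_near _ _ _ _ s e Hs Lr Lr') as H.
  replace (c + RtoC (r + s * (r' - r)) * (w - c))%C with
    (c + r * (w - c) + s * (c + r' * (w - c) - (c + r * (w - c))))%C; auto.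
  rewrite RtoC_plus, RtoC_mult, RtoC_minus. ring.
Qed.

Lemma tube_open (c w : C) (t e : R) (x : C) : tube c w t e x ->
  exists d, 0 < d /\ forall y, Cmod (y - x) < d -> tube c w t e y.
Proof.
  intros [r [Hr Lr]]. exists (e - Cmod (x - (c + RtoC r * (w - c)))). split; [lra|].
  intros y Hy. exists r. split; auto.
  pose proof (Cmod_sub_triangle y x (c + RtoC r * (w - c))). lra.
Qed.

Lemma tube_spine (c w : C) (t e : R) : 0 < e -> 0 <= t -> tube c w t e (c + RtoC t * (w - c)).
Proof. intros He Ht. exists t. split; [lra|]. rewrite Cmod_sub_diag. auto. Qed.

Lemma tube_start (c w : C) (t e : R) : 0 < e -> 0 <= t -> tube c w t e c.
Proof.
  intros He Ht. exists 0. split; [lra|].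
  replace (c - (c + 0 * (w - c)))%C with (RtoC 0) by ring. rewrite Cmod_0. auto.
Qed.

(** Near [y t], the values of [f] lie in an evenly covered set, and a section [k] of [p] extends the
    lift by [k (f z)]. The sheet is the one containing the value of the lift at [y s], so both lifts
    agree on the convex set where the tube meets the ball. The tube may become thinner at each
    extension. *)
Lemma lift_exists_tube (p f : C -> C) (A B X : C -> Prop) (a c w : C) :
  covering_map p A B -> convex X -> open X ->
  (forall z, X z -> ccont f z /\ B (f z)) ->
  X c -> X w -> A a -> p a = f c ->
  exists e, 0 < e /\ exists g : C -> C, g c = a /\
    forall z, tube c w 1 e z -> ccont g z /\ A (g z) /\ p (g z) = f z.
Proof.
  intros Hp CX OX Hf Xc Xw Aa Ea.
  pose proof Hp as [_ [_ Hcov]].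
  set (y := fun t => (c + RtoC t * (w - c))%C).
  apply (interval_induction (fun t => exists e, 0 < e /\ exists g : C -> C, g c = a /\
    forall z, tube c w t e z -> ccont g z /\ A (g z) /\ p (g z) = f z)).
  - destruct (Hf c Xc) as [Cf Bf].
    destruct (Hcov _ Bf) as [U [OU [Uc [_ [I [V [VO [VD [VA VH]]]]]]]]].
    destruct (proj1 (VA a)) as [i Hi]; [split; auto; rewrite Ea; auto|].
    destruct (VH i) as [_ [s [Hs1 Hs2]]].
    destruct (ccont_preimage f c U Cf OU Uc) as [d1 [Hd1 H1]].
    destruct (open_Cmod X c OX Xc) as [d2 [Hd2 H2]].
    exists (Rmin d1 d2). split; [apply Rmin_pos; auto|].
    exists (fun z => s (f z)). split; [rewrite <- Ea; auto|].
    intros z [r [Hr Lr]]. assert (r = 0) by lra. subst r.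
    replace (c + 0 * (w - c))%C with c in Lr by ring.
    pose proof (Rmin_l d1 d2). pose proof (Rmin_r d1 d2).
    destruct (Hs1 (f z)) as [Vz [Cs Es]]; [apply H1; lra|].
    split; [|split; auto; apply VA; exists i; auto].
    apply (ccont_comp s f); [|apply continuous_ccont; auto].
    apply Hf. apply H2. lra.
  - intros t Ht.
    assert (Xt : X (y t)) by (apply CX; auto).
    destruct (Hf _ Xt) as [Cf Bf].
    destruct (Hcov _ Bf) as [U [OU [Ut [_ [I [V [VO [VD [VA VH]]]]]]]]].
    destruct (ccont_preimage f (y t) U Cf OU Ut) as [d1 [Hd1 H1]].
    destruct (open_Cmod X (y t) OX Xt) as [d2 [Hd2 H2]].
    set (d := Rmin d1 d2). assert (Hd : 0 < d) by (apply Rmin_pos; auto).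
    pose proof (Rmin_l d1 d2). pose proof (Rmin_r d1 d2). fold d in H, H0.
    pose proof (Cmod_ge_0 (w - c)) as Hwc.
    (* One half of [d] is for the distance along the segment, the other for the width of the new
       tube. *)
    exists (d / 2 / (Cmod (w - c) + 1)). split; [apply Rdiv_lt_0_compat; lra|].
    assert (near : forall s, Rabs (s - t) < d / 2 / (Cmod (w - c) + 1) ->
       Cmod (y s - y t) < d / 2).
    { intros s Hst. unfold y. rewrite segment_dist.
      apply Rmult_lt_compat_r with (r := Cmod (w - c) + 1) in Hst; [|lra].
      replace (d / 2 / (Cmod (w - c) + 1) * (Cmod (w - c) + 1)) with (d / 2)
        in Hst by (field; lra).
      pose proof (Rabs_pos (s - t)). nra. }
    intros s s' Hs Hs' Ls Ls' [e [He [g [gc Hg]]]].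
    pose proof (tube_spine c w s e He ltac:(lra)) as Ts. fold (y s) in Ts.
    destruct (Hg _ Ts) as [Cgs [Ags Egs]].
    assert (Us : U (f (y s))) by (apply H1; specialize (near s Ls); lra).
    destruct (proj1 (VA (g (y s)))) as [i Hi]; [split; auto; rewrite Egs; auto|].
    destruct (VH i) as [_ [k [Hk1 Hk2]]].
    assert (Hkf : forall z, Cmod (z - y t) < d -> ccont (fun x => k (f x)) z /\ A (k (f z))
       /\ p (k (f z)) = f z).
    { intros z Hz. destruct (Hk1 (f z)) as [Vz [Cs Es]]; [apply H1; lra|].
      split; [|split; auto; apply VA; exists i; auto].
      apply (ccont_comp k f); [|apply continuous_ccont; auto].
      apply Hf. apply H2. lra. }
    assert (agree : forall z, tube c w s e z /\ Cmod (z - y t) < d -> g z = k (f z)).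
    { apply (lift_unique p g (fun z => k (f z)) A B _ (y s)); auto.
      - apply convex_inter; [apply tube_convex|apply convex_ball].
      - split; auto. specialize (near s Ls). lra.
      - intros z [Tz _]. destruct (Hg z Tz) as [? [? ?]]. auto.
      - intros z [_ Bz]. destruct (Hkf z Bz) as [? [? ?]]. auto.
      - intros z [Tz Bz]. destruct (Hg z Tz) as [_ [_ ->]]. destruct (Hkf z Bz) as [_ [_ ->]].
        auto.
      - rewrite <- Egs. symmetry. apply Hk2. auto. }
    set (g' := fun z => if excluded_middle_informative (tube c w s e z) then g z else k (f z)).
    assert (g'1 : forall z, tube c w s e z -> g' z = g z).
    { intros z Tz. unfold g'. destruct (excluded_middle_informative _); easy. }
    assert (g'2 : forall z, Cmod (z - y t) < d -> g' z = k (f z)).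
    { intros z Bz. unfold g'. destruct (excluded_middle_informative _); auto. }
    exists (Rmin e (d / 2)). split; [apply Rmin_pos; lra|].
    exists g'. split. { rewrite g'1; auto. apply tube_start; lra. }
    intros z [r [Hr Lr]]. pose proof (Rmin_l e (d / 2)). pose proof (Rmin_r e (d / 2)).
    (* Either [z] is in the old tube, or it is near a point with parameter between [s] and [s'],
       hence in the ball about [y t]. *)
    destruct (Rle_lt_dec r s) as [Hrs|Hrs].
    + assert (Tz : tube c w s e z) by (exists r; split; lra).
      rewrite g'1 by auto. destruct (Hg z Tz) as [Cz Hz]. split; auto.
      destruct (tube_open _ _ _ _ _ Tz) as [d3 [Hd3 H5]].
      apply ccont_ext_loc with g d3; auto. intros x Hx. symmetry. auto.
    + assert (Bz : Cmod (z - y t) < d).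
      { assert (Lrt : Rabs (r - t) < d / 2 / (Cmod (w - c) + 1)).
        { apply Rabs_def2 in Ls. apply Rabs_def2 in Ls'. apply Rabs_def1; lra. }
        specialize (near r Lrt). fold (y r) in Lr.
        pose proof (Cmod_sub_triangle z (y r) (y t)). lra. }
      rewrite g'2 by auto. destruct (Hkf z Bz) as [Cz Hz]. split; auto.
      apply ccont_ext_loc with (fun x => k (f x)) (d - Cmod (z - y t)); auto; [lra|].
      intros x Hx. symmetry. apply g'2. pose proof (Cmod_sub_triangle x z (y t)). lra.
Qed.

(** The value at [z] is that of the lift along the segment from [c] to [z]. Tubes towards different
    endpoints meet in a convex set containing [c], so near [w] these values are given by the single
    lift on the tube of [w], which yields continuity. *)
Lemma lift_exists (p f : C -> C) (A B X : C -> Prop) (a c : C) :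
  covering_map p A B -> convex X -> open X ->
  (forall z, X z -> ccont f z /\ B (f z)) ->
  X c -> A a -> p a = f c ->
  exists g : C -> C, g c = a /\
    forall z, X z -> ccont g z /\ A (g z) /\ p (g z) = f z.
Proof.
  intros Hp CX OX Hf Xc Aa Ea.
  destruct (choice (fun w (eg : R * (C -> C)) => X w -> 0 < fst eg /\ snd eg c = a /\
    forall z, tube c w 1 (fst eg) z ->
      ccont (snd eg) z /\ A (snd eg z) /\ p (snd eg z) = f z)) as [F HF].
  { intros w. destruct (classic (X w)) as [Xw|N]; [|exists (0, fun _ => c); easy].
    destruct (lift_exists_tube p f A B X a c w) as [e [He [g [gc Hg]]]]; auto.
    exists (e, g). simpl. auto. }
  assert (self : forall w, X w -> tube c w 1 (fst (F w)) w).
  { intros w Xw. destruct (HF w Xw) as [He _].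
    pose proof (tube_spine c w 1 _ He ltac:(lra)) as T.
    replace (c + 1 * (w - c))%C with w in T by ring. exact T. }
  assert (agree : forall w z, X w -> X z -> tube c w 1 (fst (F w)) z ->
     snd (F z) z = snd (F w) z).
  { intros w z Xw Xz Tz. destruct (HF w Xw) as [Hw [gw Gw]]. destruct (HF z Xz) as [Hz [gz Gz]].
    apply (lift_unique p (snd (F z)) (snd (F w)) A B
      (fun x => tube c z 1 (fst (F z)) x /\ tube c w 1 (fst (F w)) x) c); auto.
    - apply convex_inter; apply tube_convex.
    - split; apply tube_start; auto; lra.
    - intros x [Tx _]. destruct (Gz x Tx) as [? [? ?]]. auto.
    - intros x [_ Tx]. destruct (Gw x Tx) as [? [? ?]]. auto.
    - intros x [Tx Tx']. destruct (Gz x Tx) as [_ [_ ->]]. destruct (Gw x Tx') as [_ [_ ->]].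
      auto.
    - congruence. }
  exists (fun z => snd (F z) z). split; [apply HF; auto|].
  intros w Xw. destruct (HF w Xw) as [Hw [gw Gw]].
  destruct (Gw w (self w Xw)) as [Cw Rw]. split; auto.
  destruct (tube_open _ _ _ _ _ (self w Xw)) as [d1 [Hd1 H1]].
  destruct (open_Cmod X w OX Xw) as [d2 [Hd2 H2]].
  apply ccont_ext_loc with (snd (F w)) (Rmin d1 d2); auto; [apply Rmin_pos; auto|].
  intros x Hx. pose proof (Rmin_l d1 d2). pose proof (Rmin_r d1 d2).
  symmetry. apply agree; auto; [apply H2|apply H1]; lra.
Qed.

(** * Holomorphic lifts and the disk automorphisms *)

Lemma covering_derivative_neq_0 (p : C -> C) (A B : C -> Prop) (a l : C) :
  covering_map p A B -> (forall z, A z -> cdiff p z) -> A a -> cder p a l -> l <> RtoC 0.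
Proof.
  intros Hp Hd Ha Hl. destruct (covering_sheet p A B a Hp Ha) as [V [OV [Va [VA Vinj]]]].
  destruct (open_Cmod V a OV Va) as [d [Hd0 H]].
  apply (injective_derivative_neq_0 p a l d); auto.
Qed.

Lemma holomorphic_lift (p f : C -> C) (A B X : C -> Prop) (a c : C) :
  Hol A B p -> covering_map p A B -> convex X -> open X -> Hol X B f ->
  X c -> A a -> p a = f c ->
  exists g : C -> C, Hol X A g /\ g c = a /\ forall z, X z -> p (g z) = f z.
Proof.
  intros [Dp _] Hp CX OX [Df Bf] Xc Aa E.
  assert (Dp' : forall z, A z -> cdiff p z) by (intros; apply ex_derive_cdiff; auto).
  assert (Df' : forall z, X z -> cdiff f z) by (intros; apply ex_derive_cdiff; auto).
  destruct (lift_exists p f A B X a c) as [g [gc Hg]]; auto.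
  { intros z Xz. split; auto. apply cdiff_cont; auto. }
  exists g. split; [split|split; auto; intros z Xz; apply Hg; auto].
  - intros z Xz. apply ex_derive_cdiff. destruct (Hg z Xz) as [Cg [Ag _]].
    destruct (Dp' _ Ag) as [l Hl]. destruct (open_Cmod X z OX Xz) as [d [Hd H]].
    apply (cdiff_lift p f g z l d); auto.
    + eapply covering_derivative_neq_0; eauto.
    + intros x Hx. apply Hg; auto.
  - intros z Xz. apply Hg; auto.
Qed.

Lemma unit_disk_convex : convex unit_disk.
Proof.
  intros x y t Hx Hy Ht.
  assert (S : forall z, Cmod z = Cmod (z - 0)) by (intros; f_equal; ring).
  unfold unit_disk in *. rewrite S in *. apply convex_ball; auto.
Qed.

Lemma unit_disk_open : open unit_disk.
Proof.
  intros z Hz. apply locally_Cmod. exists (1 - Cmod z). unfold unit_disk in *.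
  split; [lra|]. intros x Hx. pose proof (Cmod_le_add_sub x z). lra.
Qed.

Lemma unit_disk_0 : unit_disk (RtoC 0).
Proof. unfold unit_disk. rewrite Cmod_0. lra. Qed.

(** The involutive automorphism of the disk exchanging [a] and 0; its modulus is the quantity [rho]
    of the hyperbolic distance. *)
Definition mobius (a z : C) : C := ((a - z) / (1 - Cconj a * z))%C.

Lemma Cmod_lt_sq (x y : C) : Cmod x ^ 2 < Cmod y ^ 2 -> Cmod x < Cmod y.
Proof. intros H. pose proof (Cmod_ge_0 x). pose proof (Cmod_ge_0 y). nra. Qed.

Lemma mobius_denom_neq_0 (a z : C) : unit_disk a -> unit_disk z ->
  (1 - Cconj a * z)%C <> RtoC 0.
Proof.
  unfold unit_disk. intros Ha Hz E.
  assert (E' : (Cconj a * z)%C = RtoC 1).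
  { replace (Cconj a * z)%C with (1 - (1 - Cconj a * z))%C by ring. rewrite E. ring. }
  apply (f_equal Cmod) in E'. rewrite Cmod_mult, Cmod_conj, Cmod_1 in E'.
  pose proof (Cmod_ge_0 a). pose proof (Cmod_ge_0 z). nra.
Qed.

Lemma mobius_in_disk (a z : C) : unit_disk a -> unit_disk z -> unit_disk (mobius a z).
Proof.
  intros Ha Hz. pose proof (mobius_denom_neq_0 a z Ha Hz) as N.
  unfold unit_disk, mobius in *. rewrite Cmod_div by auto.
  assert (P : 0 < Cmod (1 - Cconj a * z)) by (apply Cmod_gt_0; auto).
  apply Rmult_lt_reg_r with (Cmod (1 - Cconj a * z)); auto.
  unfold Rdiv. rewrite Rmult_assoc, Rinv_l, Rmult_1_l, Rmult_1_r by lra.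
  apply Cmod_lt_sq.
  assert (Ha2 : Cmod a ^ 2 < 1) by (pose proof (Cmod_ge_0 a); nra).
  assert (Hz2 : Cmod z ^ 2 < 1) by (pose proof (Cmod_ge_0 z); nra).
  (* The identity behind this is [|1 - conj a z|^2 - |a - z|^2 = (1 - |a|^2) (1 - |z|^2)]. *)
  rewrite !Cmod2_alt in *. destruct a as [a1 a2], z as [z1 z2]. unfold Re, Im in *. simpl in *. nra.
Qed.

Lemma mobius_involutive (a z : C) : unit_disk a -> unit_disk z -> mobius a (mobius a z) = z.
Proof.
  intros Ha Hz. pose proof (mobius_denom_neq_0 a z Ha Hz) as N.
  pose proof (mobius_denom_neq_0 a a Ha Ha) as N'.
  unfold mobius. field. split; auto.
  replace (1 - Cconj a * z - Cconj a * (a - z))%C with (1 - Cconj a * a)%C by ring. auto.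
Qed.

Lemma mobius_self (a : C) : mobius a a = RtoC 0.
Proof. unfold mobius, Cdiv, Cminus. rewrite Cplus_opp_r. ring. Qed.

Lemma mobius_0 (a : C) : mobius a 0 = a.
Proof.
  unfold mobius. replace (1 - Cconj a * 0)%C with (RtoC 1) by ring.
  field.
Qed.

Lemma mobius_Hol (a : C) : unit_disk a -> Hol unit_disk unit_disk (mobius a).
Proof.
  intros Ha. split; [|intros z; apply mobius_in_disk; auto].
  intros z Hz. apply ex_derive_cdiff.
  apply (cdiff_ext_loc (fun x => (a + -(1) * x) * / (1 + (- Cconj a) * x))%C _ z 1); [lra| |].
  - intros x _. unfold mobius, Cdiv. f_equal; [|f_equal]; ring.
  - apply cdiff_mult.
    + apply cdiff_plus; [apply cdiff_const|]. apply cdiff_mult; [apply cdiff_const|apply cdiff_id].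
    + apply cdiff_inv.
      * apply cdiff_plus; [apply cdiff_const|].
        apply cdiff_mult; [apply cdiff_const|apply cdiff_id].
      * replace (1 + - Cconj a * z)%C with (1 - Cconj a * z)%C by ring.
        apply mobius_denom_neq_0; auto.
Qed.

Lemma Hol_comp (X Y Z : C -> Prop) (f g : C -> C) :
  Hol X Y g -> Hol Y Z f -> Hol X Z (fun z => f (g z)).
Proof.
  intros [Dg Yg] [Df Zf]. split; auto. intros z Xz. apply ex_derive_cdiff.
  apply (cdiff_comp f g); apply ex_derive_cdiff; auto.
Qed.

(** The Schwarz lemma for [mobius (g a) o g o mobius a], which fixes 0, at the point
    [mobius a b]. *)
Lemma schwarz_pick (g : C -> C) (a b : C) : Hol unit_disk unit_disk g ->
  unit_disk a -> unit_disk b ->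
  Cmod (mobius (g a) (g b)) <= Cmod (mobius a b).
Proof.
  intros Hg Ha Hb. pose proof (proj2 Hg a Ha) as Hga.
  assert (H : Hol unit_disk unit_disk (fun z => mobius (g a) (g (mobius a z)))).
  { apply (Hol_comp _ unit_disk _ (mobius (g a)) (fun z => g (mobius a z))).
    - apply (Hol_comp _ unit_disk _ g (mobius a)); auto. apply mobius_Hol; auto.
    - apply mobius_Hol; auto. }
  rewrite <- (mobius_involutive a b Ha Hb) at 1.
  apply (schwarz (fun z => mobius (g a) (g (mobius a z)))).
  - intros z Hz. destruct H as [H1 H2]. split; [apply ex_derive_cdiff; auto|apply H2; auto].
  - rewrite mobius_0. apply mobius_self.
  - apply mobius_in_disk; auto.
Qed.

Lemma d_disk_mobius (a b : C) :
  d_disk a b = ln ((1 + Cmod (mobius a b)) / (1 - Cmod (mobius a b))).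
Proof.
  assert (E : Cmod ((a - b) / (1 - a * Cconj b)) = Cmod (mobius a b)).
  (* The two denominators are conjugate, so they vanish together and otherwise have equal moduli. *)
  { unfold mobius. destruct (classic ((1 - Cconj a * b)%C = RtoC 0)) as [Z|N].
    - assert (Z' : (1 - a * Cconj b)%C = RtoC 0).
      { apply Cmod_eq_0. rewrite <- Cmod_conj, <- Cmod_0, <- Z. f_equal.
        destruct a, b. unfold Cconj, Cminus, Cplus, Cmult, Copp, RtoC. simpl. f_equal; ring. }
      rewrite Z, Z'. auto.
    - assert (Em : Cmod (1 - a * Cconj b) = Cmod (1 - Cconj a * b)).
      { rewrite <- Cmod_conj. f_equal.
        destruct a, b. unfold Cconj, Cminus, Cplus, Cmult, Copp, RtoC. simpl. f_equal; ring. }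
      rewrite !Cmod_div, Em; auto. intros Z. apply N. apply Cmod_eq_0. rewrite <- Em, Z.
      apply Cmod_0. }
  unfold d_disk. rewrite E. reflexivity.
Qed.

(** * The hyperbolic distance of the domain and weighted bounds *)

Definition tanh_half (d : R) : R := (exp d - 1) / (exp d + 1).

Lemma tanh_half_ln (r : R) : 0 <= r < 1 -> tanh_half (ln ((1 + r) / (1 - r))) = r.
Proof.
  intros Hr. unfold tanh_half. rewrite exp_ln by (apply Rdiv_lt_0_compat; lra). field. lra.
Qed.

Lemma tanh_half_alt (d : R) : tanh_half d = 1 - 2 * / (exp d + 1).
Proof. unfold tanh_half. pose proof (exp_pos d). field. lra. Qed.

Lemma tanh_half_le (d d' : R) : d <= d' -> tanh_half d <= tanh_half d'.
Proof.
  intros H. rewrite !tanh_half_alt. pose proof (exp_pos d).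
  assert (exp d <= exp d').
  { destruct H as [H| ->]; [left; apply exp_increasing; auto|lra]. }
  assert (/ (exp d' + 1) <= / (exp d + 1)) by (apply Rinv_le_contravar; lra). lra.
Qed.

Lemma tanh_half_range (d : R) : 0 <= d -> 0 <= tanh_half d < 1.
Proof.
  intros H. split.
  - replace 0 with (tanh_half 0); [apply tanh_half_le; auto|].
    unfold tanh_half. rewrite exp_0. field.
  - rewrite tanh_half_alt. pose proof (exp_pos d).
    assert (0 < / (exp d + 1)) by (apply Rinv_0_lt_compat; lra). lra.
Qed.

Lemma tanh_half_continuous (d e : R) : 0 < e -> exists h, 0 < h /\
  forall x, Rabs (x - d) < h -> Rabs (tanh_half x - tanh_half d) < e.
Proof.
  intros He.
  assert (Hc : continuous tanh_half d).
  { apply (ex_derive_continuous (K := R_AbsRing) (V := R_NormedModule)).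
    unfold tanh_half. pose proof (exp_pos d). auto_derive. lra. }
  destruct (proj1 (filterlim_locally _ _) Hc (mkposreal e He)) as [h H].
  exists h. split; [apply cond_pos|]. intros x Hx. apply (H x Hx).
Qed.

Lemma Lub_lt_p_infty (E : R -> Prop) :
  Rbar_lt (Lub_Rbar E) p_infty <-> exists M, forall x, E x -> x <= M.
Proof.
  destruct (Lub_Rbar_correct E) as [H1 H2]. split.
  - intros H. destruct (Lub_Rbar E) as [M| |].
    + exists M. intros x Ex. apply (H1 x Ex).
    + easy.
    (* The supremum is [m_infty] only for the empty set, so any bound will do. *)
    + exists 0. intros x Ex. elim (H1 x Ex).
  - intros [M HM]. specialize (H2 (Finite M) HM).
    destruct (Lub_Rbar E); simpl in *; auto.
Qed.

Lemma H_v_bound (v : C -> R) (f : C -> C) : H_v v f <->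
  holomorphic_on unit_disk f /\ exists M, forall z, unit_disk z -> Cmod (f z) * v z <= M.
Proof.
  unfold H_v, sup_v. rewrite Lub_lt_p_infty. split; intros [H [M HM]]; split; auto; exists M.
  - intros z Hz. apply HM. exists z. auto.
  - intros x [z [Hz ->]]. auto.
Qed.

(** Maps are total on [C], whereas lifting identities hold on the disk only; the disk being open,
    these determine derivatives there. *)
Lemma H_v_ext (v : C -> R) (f g : C -> C) : (forall z, unit_disk z -> f z = g z) ->
  H_v v f -> H_v v g.
Proof.
  intros E. rewrite !H_v_bound. intros [Hf [M HM]]. split.
  - intros z Hz. apply ex_derive_cdiff.
    destruct (open_Cmod _ z unit_disk_open Hz) as [d [Hd H]].
    apply (cdiff_ext_loc f g z d); auto. apply ex_derive_cdiff; auto.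
  - exists M. intros z Hz. rewrite <- E; auto.
Qed.

(** Surjectivity of the covering makes the set of distances nonempty, and 0 bounds it below; the
    infimum is therefore finite and [real] returns it rather than a default value. *)
Lemma d_hyp_spec (p : C -> C) (Omega : C -> Prop) (x y : C) :
  covering_map p unit_disk Omega -> Omega x -> Omega y ->
  0 <= d_hyp p x y /\
  (forall a b, unit_disk a -> unit_disk b -> p a = x -> p b = y ->
     d_hyp p x y <= d_disk a b) /\
  (forall e, 0 < e -> exists a b, unit_disk a /\ unit_disk b /\ p a = x /\ p b = y /\
     d_disk a b < d_hyp p x y + e).
Proof.
  intros [_ [Hs _]] Hx Hy. destruct (Hs x Hx) as [a0 [Ha0 Ea0]].
  destruct (Hs y Hy) as [b0 [Hb0 Eb0]]. unfold d_hyp. set (E := fun d => _).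
  destruct (Glb_Rbar_correct E) as [H1 H2].
  assert (L0 : Rbar_le 0 (Glb_Rbar E)).
  { apply H2. intros d [a [b [Ha [Hb [_ [_ ->]]]]]]. simpl. rewrite d_disk_mobius.
    pose proof (mobius_in_disk a b Ha Hb) as Hm. unfold unit_disk in Hm.
    pose proof (Cmod_ge_0 (mobius a b)). rewrite <- ln_1. apply ln_le; [lra|].
    apply Rmult_le_reg_r with (1 - Cmod (mobius a b)); [lra|].
    unfold Rdiv. rewrite Rmult_assoc, Rinv_l by lra. lra. }
  assert (U0 : Rbar_le (Glb_Rbar E) (d_disk a0 b0)).
  { apply H1. exists a0, b0. auto. }
  destruct (Glb_Rbar E) as [D| |]; simpl in L0, U0; try easy. simpl.
  repeat split; auto.
  - intros a b Ha Hb Ea Eb. apply (H1 (d_disk a b)). exists a, b. auto.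
  - intros e He. apply NNPP. intros N.
    assert (L : Rbar_le (D + e) D); [|simpl in L; lra].
    apply H2. intros d [a [b [Ha [Hb [Ea [Eb ->]]]]]]. simpl. apply Rnot_lt_le. intros L.
    apply N. exists a, b. auto.
Qed.

(** * Equivalence of the three growth conditions *)

Theorem theorem3p3 (Omega : C -> Prop) (fOmega : C -> C) (v : C -> R)
    (hOmega : hyperbolic_domain Omega)
    (hf : holomorphic_universal_covering Omega fOmega)
    (hv : typical_weight v)
    (hC : forall g : C -> C, Hol unit_disk unit_disk g -> composition_bounded v g)
    (h0 : Omega (RtoC 0)) :
  ((forall f : C -> C, Hol unit_disk Omega f -> H_v v f) <-> H_v v fOmega) /\
  (H_v v fOmega <->
   Rbar_lt
     (Lub_Rbar (fun x : R => exists w : C, Omega w /\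
        x = Cmod w *
            v (RtoC ((exp (d_hyp fOmega (RtoC 0) w) - 1) /
                     (exp (d_hyp fOmega (RtoC 0) w) + 1)))))
     p_infty).
Proof.
  destruct hf as [Hhol Hcov]. destruct hv as [Vpos [Vrad [Vcont [Vmon _]]]].
  pose proof (proj1 (proj2 Hcov)) as Hsurj.
  assert (comp : forall g, Hol unit_disk unit_disk g -> forall f, H_v v f ->
     H_v v (fun z => f (g z))).
  { intros g Hg f Hf. destruct (hC g Hg) as [M HM]. apply HM. exact Hf. }
  destruct (Hsurj _ h0) as [a0 [Ha0 Ea0]].
  split; split.
  - intros H. apply H. exact Hhol.
  - intros Hb f Hf. destruct (Hsurj (f (RtoC 0))) as [a [Ha Ea]].
    { apply Hf. apply unit_disk_0. }
    destruct (holomorphic_lift fOmega f unit_disk Omega unit_disk a (RtoC 0))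
      as [g [Hg [_ Eg]]]; auto using unit_disk_convex, unit_disk_open, unit_disk_0.
    apply H_v_ext with (fun z => fOmega (g z)); auto.
  - intros Hb. apply Lub_lt_p_infty.
    pose proof (comp _ (mobius_Hol a0 Ha0) _ Hb) as Hm.
    apply H_v_bound in Hm. destruct Hm as [_ [M HM]].
    exists M. intros x [w [Hw ->]].
    change (Cmod w * v (RtoC (tanh_half (d_hyp fOmega (RtoC 0) w))) <= M).
    destruct (d_hyp_spec fOmega Omega (RtoC 0) w Hcov h0 Hw) as [D0 [_ Dinf]].
    set (D := d_hyp fOmega (RtoC 0) w) in *.
    (* The bound [M] for [fOmega o mobius a0] is used at [mobius a0 (g b)], which is sent to [w]. By
       Schwarz-Pick its modulus is at most that of [mobius a b], where [v] is no larger. *)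
    assert (key : forall a b, unit_disk a -> unit_disk b -> fOmega a = RtoC 0 -> fOmega b = w ->
       Cmod w * v (RtoC (Cmod (mobius a b))) <= M).
    { intros a b Ha Hb' Ea Eb.
      destruct (holomorphic_lift fOmega fOmega unit_disk Omega unit_disk a0 a)
        as [g [Hg [ga Eg]]]; auto using unit_disk_convex, unit_disk_open; [congruence|].
      pose proof (schwarz_pick g a b Hg Ha Hb') as SP. rewrite ga in SP.
      pose proof (proj2 Hg b Hb') as Hgb.
      specialize (HM _ (mobius_in_disk a0 (g b) Ha0 Hgb)). simpl in HM.
      rewrite mobius_involutive, Eg, Eb in HM by auto.
      eapply Rle_trans; [|exact HM]. apply Rmult_le_compat_l; [apply Cmod_ge_0|].
      rewrite <- Vrad by (apply mobius_in_disk; auto).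
      apply Vmon; auto; apply mobius_in_disk; auto. }
    (* [key] controls [v] at the moduli of pairs, which are at least [tanh_half D], so [v] at
       [tanh_half D] could be larger. A pair whose distance is close to [D], together with
       continuity of [v], excludes an excess over [M]. *)
    apply Rnot_lt_le. intros L.
    pose proof (tanh_half_range D D0) as HT.
    assert (UT : unit_disk (RtoC (tanh_half D))).
    { unfold unit_disk. rewrite Cmod_R, Rabs_pos_eq; lra. }
    pose proof (Cmod_ge_0 w) as Hw0.
    (* A change of [v] by less than [eta], multiplied by [|w|], cannot close the gap above [M]. *)
    set (eta := (Cmod w * v (RtoC (tanh_half D)) - M) / (Cmod w + 1)).
    assert (Heta : 0 < eta) by (unfold eta; apply Rdiv_lt_0_compat; lra).
    assert (Eeta : eta * (Cmod w + 1) = Cmod w * v (RtoC (tanh_half D)) - M)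
      by (unfold eta; field; lra).
    pose proof (proj1 (filterlim_locally _ _) (Vcont _ UT) (mkposreal eta Heta)) as Hloc.
    apply locally_Cmod in Hloc. destruct Hloc as [d [Hd Hloc]].
    destruct (tanh_half_continuous D d Hd) as [h [Hh Hth]].
    destruct (Dinf h Hh) as [a [b [Ha [Hb' [Ea [Eb Hab]]]]]].
    destruct (d_hyp_spec fOmega Omega (RtoC 0) w Hcov h0 Hw) as [_ [Dle _]].
    specialize (Dle a b Ha Hb' Ea Eb). fold D in Dle.
    specialize (key a b Ha Hb' Ea Eb).
    assert (Er : tanh_half (d_disk a b) = Cmod (mobius a b)).
    { rewrite d_disk_mobius. apply tanh_half_ln.
      split; [apply Cmod_ge_0|apply mobius_in_disk; auto]. }
    specialize (Hth (d_disk a b)). rewrite Er in Hth.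
    specialize (Hloc (RtoC (Cmod (mobius a b)))).
    rewrite <- RtoC_minus, Cmod_R in Hloc.
    specialize (Hloc (Hth ltac:(apply Rabs_def1; lra))).
    change (Rabs (v (RtoC (Cmod (mobius a b))) - v (RtoC (tanh_half D))) < eta) in Hloc.
    apply Rabs_def2 in Hloc. nra.
  - intros Hc. apply Lub_lt_p_infty in Hc. destruct Hc as [M HM].
    assert (Hm : H_v v (fun z => fOmega (mobius a0 z))).
    { apply H_v_bound. split.
      - apply (Hol_comp unit_disk unit_disk Omega fOmega (mobius a0)); auto.
        apply mobius_Hol; auto.
      - exists M. intros z Hz. pose proof (mobius_in_disk a0 z Ha0 Hz) as Hmz.
        set (y := mobius a0 z) in *.
        assert (Hw : Omega (fOmega y)) by (apply Hhol; auto).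
        eapply Rle_trans; [|apply HM; exists (fOmega y); split; [auto|reflexivity]].
        apply Rmult_le_compat_l; [apply Cmod_ge_0|].
        destruct (d_hyp_spec fOmega Omega (RtoC 0) (fOmega y) Hcov h0 Hw) as [D0 [Dle _]].
        (* Since [mobius a0 y = z], this pair gives [tanh_half] of the distance at most [|z|], so
           [v z] is at most the weight occurring in (c). *)
        specialize (Dle a0 y Ha0 Hmz Ea0 eq_refl).
        pose proof (tanh_half_range _ D0) as HT. apply tanh_half_le in Dle.
        rewrite d_disk_mobius, tanh_half_ln in Dle
          by (split; [apply Cmod_ge_0|apply mobius_in_disk; auto]).
        unfold y in Dle at 2. rewrite mobius_involutive in Dle by auto.
        fold (tanh_half (d_hyp fOmega (RtoC 0) (fOmega y))).
        assert (Ec : Cmod (RtoC (tanh_half (d_hyp fOmega (RtoC 0) (fOmega y))))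
            = tanh_half (d_hyp fOmega (RtoC 0) (fOmega y)))
          by (rewrite Cmod_R, Rabs_pos_eq; lra).
        apply Vmon; auto; unfold unit_disk; rewrite Ec; lra. }
    apply H_v_ext with (fun z => fOmega (mobius a0 (mobius a0 z))).
    + intros z Hz. rewrite mobius_involutive; auto.
    + apply (comp (mobius a0) (mobius_Hol a0 Ha0) _ Hm).
Qed.
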